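(* Let $R$ be a commutative ring with $1$, let $n\ge1$, let $(\mathcal C,\mathbb E,\mathfrak s)$ be a small $R$-linear extriangulated category and let $\mathcal X=\operatorname{add}\mathcal X$ be a strongly functorially finite $n$-rigid subcategory of $\mathcal C$. Then the following conditions are equivalent: (1) $\displaystyle\mathcal X=\bigcap_{i=1}^{n}{}^{\perp_i}\mathcal X=\bigcap_{i=1}^{n}\mathcal X^{\perp_i}$; (2) $\Sigma_{\mathcal X}^{n}\cong\mathbf 0$ as endofunctors of $\mathcal C/[\mathcal X]$; (3) $\Omega_{\mathcal X}^{n}\cong\mathbf 0$ as endofunctors of $\mathcal C/[\mathcal X]$.
   Context: Conventions: all categories are additive; subcategories are full and closed under isomorphisms; $\mathcal X=\operatorname{add}\mathcal X$ means $\mathcal X$ is closed under finite direct sums and direct summands; a category is small if its objects and morphisms form sets. Extriangulated categories $(\mathcal C,\mathbb E,\mathfrak s)$ are in the sense of Nakaoka--Palu; an $\mathbb E$-triangle is written $A\to B\to C\dashrightarrow$ and realizes an element of $\mathbb E(C,A)$. $R$-linear means that $\mathcal C$ is $R$-linear and $\mathbb E$ is an $R$-bilinear bifunctor $\mathcal C^{\mathrm{op}}\times\mathcal C\to R\text{-Mod}$. Positive higher extensions (Gorsky--Nakaoka--Palu): $\mathbb E^1=\mathbb E$ and $\mathbb E^i=\mathbb E^{\diamond i}$ is the $i$-fold tensor product of the $\mathcal C$-bimodule $\mathbb E$ over $\mathcal C$, i.e. $\mathbb E^{i}(C,A)=\int^{M\in\mathcal C}\mathbb E^{i-1}(C,M)\otimes_R\mathbb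 E(M,A)$. It is known that each $\mathbb E$-triangle induces long exact sequences $\mathcal C(X,A)\to\mathcal C(X,B)\to\mathcal C(X,C)\to\mathbb E(X,A)\to\mathbb E(X,B)\to\mathbb E(X,C)\to\mathbb E^2(X,A)\to\cdots$ and the contravariant analogue. $\mathcal X$ is $n$-rigid if $\mathbb E^i(X,X')=0$ for all $X,X'\in\mathcal X$ and $1\le i\le n$. For $i\ge1$, ${}^{\perp_i}\mathcal X=\{A\mid \mathbb E^i(A,X)=0\ \forall X\in\mathcal X\}$ and $\mathcal X^{\perp_i}=\{A\mid \mathbb E^i(X,A)=0\ \forall X\in\mathcal X\}$. A left $\mathcal X$-approximation of $A$ is a morphism $x_A:A\to X_A$ with $X_A\in\mathcal X$ through which every morphism from $A$ to an object of $\mathcal X$ factors; right approximations are dual. $\mathcal X$ is strongly covariantly finite if each $A\in\mathcal C$ admits an $\mathbb E$-triangle $A\xrightarrow{x_A}X_A\to A^+\dashrightarrow$ with $x_A$ a left $\mathcal X$-approximation; strongly contravariantly finite is dual: each $A$ admits an $\mathbb E$-triangle $A^-\to X^A\to A\dashrightarrow$ whose second morphism is a right $\mathcal X$-approximation. Strongly functorially finite means both. $\mathcal C/[\mathcal X]$ is the ideal quotient by the morphisms factoring through objects of $\mathcal X$, with quotient functor $\pi_{\mathcal X}$. The canonical suspension $\Sigma_{\mathcal X}:\mathcal C/[\mathcal X]\to\mathcal C/[\mathcal X]$ is given by $\Sigma_{\mathcal X}(\pi_{\mathcal X}A)=\pi_{\mathcal X}(A^+)$ for chosen left approximation $\mathbb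 E$-triangles; on $f:A\to B$ one completes $f$ to a morphism $(f,g,h)$ of the chosen $\mathbb E$-triangles and sets $\Sigma_{\mathcal X}(\pi_{\mathcal X}f)=\pi_{\mathcal X}h$ (well defined, and independent of choices up to natural isomorphism). The canonical loop $\Omega_{\mathcal X}$ is defined dually, with $\Omega_{\mathcal X}(\pi_{\mathcal X}A)=\pi_{\mathcal X}(A^-)$. It is known (Zhou--Zhu) that these make $\mathcal C/[\mathcal X]$ a pretriangulated category in the sense of Beligiannis--Reiten; in particular $\Sigma_{\mathcal X}$ is left adjoint to $\Omega_{\mathcal X}$. $\mathbf 0$ denotes the zero endofunctor. *)

(* Defs.v *)
From HB Require Import structures.
From mathcomp Require Import all_boot all_order all_algebra.
From mathcomp Require Import boolp.

Set Implicit Arguments.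
Unset Strict Implicit.
Unset Printing Implicit Defensive.

Import GRing.Theory.
Local Open Scope ring_scope.
Local Open Scope quotient_scope.

#[local] Obligation Tactic := idtac.

(** [smodule R] is an R-module "up to an equivalence relation", and [smodq M]
    is the genuine R-module obtained by passing to equivalence classes. *)

Record smodule (R : pzRingType) := SModule {
  sm_sort :> Type;
  sm_eq : sm_sort -> sm_sort -> Prop;
  sm_zero : sm_sort;
  sm_add : sm_sort -> sm_sort -> sm_sort;
  sm_scale : R -> sm_sort -> sm_sort;
  sm_refl : forall x, sm_eq x x;
  sm_sym : forall x y, sm_eq x y -> sm_eq y x;
  sm_trans : forall x y z, sm_eq x y -> sm_eq y z -> sm_eq x z;
  sm_addW : forall x x' y y',
    sm_eq x x' -> sm_eq y y' -> sm_eq (sm_add x y) (sm_add x' y');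
  sm_scaleW : forall k x x', sm_eq x x' -> sm_eq (sm_scale k x) (sm_scale k x');
  sm_addA : forall x y z,
    sm_eq (sm_add x (sm_add y z)) (sm_add (sm_add x y) z);
  sm_addC : forall x y, sm_eq (sm_add x y) (sm_add y x);
  sm_add0 : forall x, sm_eq (sm_add sm_zero x) x;
  sm_scaleA : forall k l x, sm_eq (sm_scale k (sm_scale l x)) (sm_scale (k * l) x);
  sm_scale0 : forall x, sm_eq (sm_scale 0 x) sm_zero;
  sm_scale1 : forall x, sm_eq (sm_scale 1 x) x;
  sm_scaleDr : forall k x y,
    sm_eq (sm_scale k (sm_add x y)) (sm_add (sm_scale k x) (sm_scale k y));
  sm_scaleDl : forall k l x,
    sm_eq (sm_scale (k + l) x) (sm_add (sm_scale k x) (sm_scale l x)) }.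

Section SModuleQuotient.
Context (R : pzRingType) (M : smodule R).

Definition smc : Type := {classic M}.
HB.instance Definition _ := Choice.on smc.

Definition sm_rel : rel smc := fun x y => `[< @sm_eq R M x y >].

Lemma sm_rel_refl : reflexive sm_rel.
Proof. by move=> x; apply/asboolP/sm_refl. Qed.

Lemma sm_rel_sym : symmetric sm_rel.
Proof. by move=> x y; apply/asboolP/asboolP; apply: sm_sym. Qed.

Lemma sm_rel_trans : transitive sm_rel.
Proof. by move=> y x z /asboolP xy /asboolP yz; apply/asboolP/sm_trans/yz. Qed.

Definition sm_equiv := EquivRel sm_rel sm_rel_refl sm_rel_sym sm_rel_trans.

Definition smodq : Type := {eq_quot sm_equiv}.
HB.instance Definition _ := Choice.on smodq.

Definition smpi (x : M) : smodq := \pi_{eq_quot sm_equiv} (x : smc).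
Definition smrepr (u : smodq) : M := repr (u : {eq_quot sm_equiv}).

Lemma smreprK u : smpi (smrepr u) = u.
Proof. exact: (@reprK _ {eq_quot sm_equiv}). Qed.

Lemma smpiP (x y : M) : smpi x = smpi y <-> sm_eq x y.
Proof.
split; first by move/(@eqmodP _ sm_equiv)/asboolP.
by move=> xy; apply/(@eqmodP _ sm_equiv)/asboolP.
Qed.

Lemma smrepr_pi x : sm_eq (smrepr (smpi x)) x.
Proof. by apply/smpiP; rewrite smreprK. Qed.

Lemma smodq_ind (P : smodq -> Prop) : (forall x, P (smpi x)) -> forall u, P u.
Proof. by move=> Ppi u; rewrite -(smreprK u). Qed.

Definition smq_add (u v : smodq) := smpi (sm_add (smrepr u) (smrepr v)).
Definition smq_scale k (u : smodq) := smpi (sm_scale k (smrepr u)).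

Lemma smq_addE x y : smq_add (smpi x) (smpi y) = smpi (sm_add x y).
Proof. by apply/smpiP/sm_addW; apply: smrepr_pi. Qed.

Lemma smq_scaleE k x : smq_scale k (smpi x) = smpi (sm_scale k x).
Proof. by apply/smpiP/sm_scaleW/smrepr_pi. Qed.

Lemma smq_addA : associative smq_add.
Proof.
elim/smodq_ind=> x; elim/smodq_ind=> y; elim/smodq_ind=> z.
by rewrite !smq_addE; apply/smpiP/sm_addA.
Qed.

Lemma smq_addC : commutative smq_add.
Proof.
elim/smodq_ind=> x; elim/smodq_ind=> y.
by rewrite !smq_addE; apply/smpiP/sm_addC.
Qed.

Lemma smq_add0 : left_id (smpi (sm_zero M)) smq_add.
Proof. by elim/smodq_ind=> x; rewrite smq_addE; apply/smpiP/sm_add0. Qed.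

HB.instance Definition _ :=
  GRing.isNmodule.Build smodq smq_addA smq_addC smq_add0.

Lemma smq_scaleA k l (u : smodq) :
  smq_scale k (smq_scale l u) = smq_scale (k * l) u.
Proof. by elim/smodq_ind: u => x; rewrite !smq_scaleE; apply/smpiP/sm_scaleA. Qed.

Lemma smq_scale0 (u : smodq) : smq_scale 0 u = 0.
Proof. by elim/smodq_ind: u => x; rewrite smq_scaleE; apply/smpiP/sm_scale0. Qed.

Lemma smq_scale1 : left_id 1 smq_scale.
Proof. by elim/smodq_ind=> x; rewrite smq_scaleE; apply/smpiP/sm_scale1. Qed.

Lemma smpiD (x y : M) : smpi (sm_add x y) = smpi x + smpi y.
Proof. by rewrite [RHS]smq_addE. Qed.

Lemma smq_scaleDr : right_distributive smq_scale +%R.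
Proof.
move=> k; elim/smodq_ind=> x; elim/smodq_ind=> y.
by rewrite -smpiD !smq_scaleE -smpiD; apply/smpiP/sm_scaleDr.
Qed.

Lemma smq_scaleDl (u : smodq) : {morph smq_scale^~ u : k l / k + l}.
Proof.
elim/smodq_ind: u => x k l; rewrite !smq_scaleE -smpiD.
exact/smpiP/sm_scaleDl.
Qed.

HB.instance Definition _ := GRing.Nmodule_isLSemiModule.Build R smodq
  smq_scaleA smq_scale0 smq_scale1 smq_scaleDr smq_scaleDl.
HB.instance Definition _ := GRing.LSemiModule_isLmodule.Build R smodq.

Lemma smpiZ k (x : M) : smpi (sm_scale k x) = k *: smpi x.
Proof. by rewrite [RHS]smq_scaleE. Qed.

Lemma smpi0 : smpi (sm_zero M) = 0. Proof. by []. Qed.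

End SModuleQuotient.

Record linear_category (R : comPzRingType) := LinearCategory {
  ob :> Type;
  hom : ob -> ob -> lmodType R;
  idm : forall A, hom A A;
  comp : forall A B D, hom B D -> hom A B -> hom A D;
  compA : forall A B D F (h : hom D F) (g : hom B D) (f : hom A B),
    comp h (comp g f) = comp (comp h g) f;
  comp1m : forall A B (f : hom A B), comp (idm B) f = f;
  compm1 : forall A B (f : hom A B), comp f (idm A) = f;
  comp_linear_l : forall A B D k (g g' : hom B D) (f : hom A B),
    comp (k *: g + g') f = k *: comp g f + comp g' f;
  comp_linear_r : forall A B D k (g : hom B D) (f f' : hom A B),
    comp g (k *: f + f') = k *: comp g f + comp g f' }.

Arguments hom {R C} A B : rename.
Arguments idm {R C} A : rename.
Arguments comp {R C A B D} g f : rename.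

Notation "g \oc f" := (comp g f) (at level 40, left associativity).

Section LinearCategoryTheory.
Context (R : comPzRingType) (C : linear_category R).
Implicit Types (A B D : C).

Lemma compDl A B D (g g' : hom B D) (f : hom A B) :
  (g + g') \oc f = g \oc f + g' \oc f.
Proof. by have := comp_linear_l 1 g g' f; rewrite !scale1r. Qed.

Lemma compDr A B D (g : hom B D) (f f' : hom A B) :
  g \oc (f + f') = g \oc f + g \oc f'.
Proof. by have := comp_linear_r 1 g f f'; rewrite !scale1r. Qed.

Lemma comp0m A B D (f : hom A B) : (0 : hom B D) \oc f = 0.
Proof. by apply: (addIr ((0 : hom B D) \oc f)); rewrite -compDl !add0r. Qed.

Lemma compm0 A B D (g : hom B D) : g \oc (0 : hom A B) = 0.
Proof. by apply: (addIr (g \oc (0 : hom A B))); rewrite -compDr !add0r. Qed.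

Lemma compZl A B D k (g : hom B D) (f : hom A B) :
  (k *: g) \oc f = k *: (g \oc f).
Proof. by rewrite -[k *: g]addr0 comp_linear_l comp0m addr0. Qed.

Lemma compZr A B D k (g : hom B D) (f : hom A B) :
  g \oc (k *: f) = k *: (g \oc f).
Proof. by rewrite -[k *: f]addr0 comp_linear_r compm0 addr0. Qed.

Lemma compNl A B D (g : hom B D) (f : hom A B) : (- g) \oc f = - (g \oc f).
Proof. by rewrite -!scaleN1r compZl. Qed.

Lemma compNr A B D (g : hom B D) (f : hom A B) : g \oc (- f) = - (g \oc f).
Proof. by rewrite -!scaleN1r compZr. Qed.

Lemma compBl A B D (g g' : hom B D) (f : hom A B) :
  (g - g') \oc f = g \oc f - g' \oc f.
Proof. by rewrite compDl compNl. Qed.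

Lemma compBr A B D (g : hom B D) (f f' : hom A B) :
  g \oc (f - f') = g \oc f - g \oc f'.
Proof. by rewrite compDr compNr. Qed.

Definition is_iso A B (f : hom A B) : Prop :=
  exists g : hom B A, g \oc f = idm A /\ f \oc g = idm B.

Record biproduct (A B P : C) := Biproduct {
  bin1 : hom A P;
  bin2 : hom B P;
  bpr1 : hom P A;
  bpr2 : hom P B;
  bpr1_in1 : bpr1 \oc bin1 = idm A;
  bpr2_in2 : bpr2 \oc bin2 = idm B;
  bpr1_in2 : bpr1 \oc bin2 = 0;
  bpr2_in1 : bpr2 \oc bin1 = 0;
  bin_pr : bin1 \oc bpr1 + bin2 \oc bpr2 = idm P }.

End LinearCategoryTheory.

Record additive_category (R : comPzRingType) := AdditiveCategory {
  add_linear :> linear_category R;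
  zero_ob : add_linear;
  zero_obP : idm zero_ob = 0;
  sum_ob : add_linear -> add_linear -> add_linear;
  sum_obP : forall A B, biproduct A B (sum_ob A B) }.

Arguments zero_ob {R} C : rename.
Arguments sum_ob {R C} A B : rename.
Arguments sum_obP {R C} A B : rename.

Record functor (R : comPzRingType) (C D : linear_category R) := Functor {
  fob :> C -> D;
  fmor : forall A B, hom A B -> hom (fob A) (fob B);
  fmor_id : forall A, fmor (idm A) = idm (fob A);
  fmor_comp : forall A B B' (g : hom B B') (f : hom A B),
    fmor (g \oc f) = fmor g \oc fmor f }.

Arguments fmor {R C D} F {A B} f : rename.

Section Functors.
Context (R : comPzRingType).
Implicit Types (C D : linear_category R).

Definition id_functor C : functor C C :=
  @Functor R C C (fun A => A) (fun A B f => f) (fun=> erefl) (fun _ _ _ _ _ => erefl).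

Program Definition comp_functor C D D' (G : functor D D') (F : functor C D) :
    functor C D' :=
  @Functor R C D' (fun A => G (F A)) (fun A B f => fmor G (fmor F f)) _ _.
Next Obligation. by move=> * /=; rewrite !fmor_id. Qed.
Next Obligation. by move=> * /=; rewrite !fmor_comp. Qed.

Fixpoint iter_functor C (n : nat) (F : functor C C) : functor C C :=
  if n is m.+1 then comp_functor F (iter_functor m F) else id_functor C.

Program Definition zero_functor C (D : additive_category R) : functor C D :=
  @Functor R C D (fun=> zero_ob D) (fun A B f => idm (zero_ob D)) (fun=> erefl) _.
Next Obligation. by move=> * /=; rewrite comp1m. Qed.

Definition nat_isomorphic C D (F G : functor C D) : Prop :=
  exists eta : forall A : C, hom (F A) (G A),
    (forall (A B : C) (f : hom A B), fmor G f \oc eta A = eta B \oc fmor F f) /\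
    (forall A : C, is_iso (eta A)).

End Functors.

(** R-bilinear bifunctors [C^op x C -> R-Mod], the first argument being the
    contravariant one: [push a] is [a_*] and [pull c] is [c^*]. *)
Record bimodule (R : comPzRingType) (C : linear_category R) := Bimodule {
  bm_ob :> C -> C -> lmodType R;
  push : forall Z A A' : C, hom A A' -> bm_ob Z A -> bm_ob Z A';
  pull : forall Z Z' A : C, hom Z' Z -> bm_ob Z A -> bm_ob Z' A;
  push_linear : forall Z A A' (a : hom A A') k (x y : bm_ob Z A),
    push a (k *: x + y) = k *: push a x + push a y;
  push_linear_hom : forall Z A A' k (a a' : hom A A') (x : bm_ob Z A),
    push (k *: a + a') x = k *: push a x + push a' x;
  push_id : forall Z A (x : bm_ob Z A), push (idm A) x = x;
  push_comp : forall Z A A' A'' (a' : hom A' A'') (a : hom A A') (x : bm_ob Z A),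
    push (a' \oc a) x = push a' (push a x);
  pull_linear : forall Z Z' A (c : hom Z' Z) k (x y : bm_ob Z A),
    pull c (k *: x + y) = k *: pull c x + pull c y;
  pull_linear_hom : forall Z Z' A k (c c' : hom Z' Z) (x : bm_ob Z A),
    pull (k *: c + c') x = k *: pull c x + pull c' x;
  pull_id : forall Z A (x : bm_ob Z A), pull (idm Z) x = x;
  pull_comp : forall Z Z' Z'' A (c : hom Z' Z) (c' : hom Z'' Z') (x : bm_ob Z A),
    pull (c \oc c') x = pull c' (pull c x);
  push_pull : forall Z Z' A A' (a : hom A A') (c : hom Z' Z) (x : bm_ob Z A),
    push a (pull c x) = pull c (push a x) }.

Arguments push {R C E Z A A'} a x : rename.
Arguments pull {R C E Z Z' A} c x : rename.

Section BimoduleTheory.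
Context (R : comPzRingType) (C : linear_category R) (F : bimodule C).

Lemma pushD Z A A' (a : hom A A') (x y : F Z A) :
  push a (x + y) = push a x + push a y.
Proof. by have := push_linear a 1 x y; rewrite !scale1r. Qed.

Lemma push0 Z A A' (a : hom A A') : push a (0 : F Z A) = 0.
Proof. by apply: (addIr (push a (0 : F Z A))); rewrite -pushD !add0r. Qed.

Lemma pushZ Z A A' (a : hom A A') k (x : F Z A) :
  push a (k *: x) = k *: push a x.
Proof. by rewrite -[k *: x]addr0 push_linear push0 addr0. Qed.

Lemma pullD Z Z' A (c : hom Z' Z) (x y : F Z A) :
  pull c (x + y) = pull c x + pull c y.
Proof. by have := pull_linear c 1 x y; rewrite !scale1r. Qed.

Lemma pull0 Z Z' A (c : hom Z' Z) : pull c (0 : F Z A) = 0.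
Proof. by apply: (addIr (pull c (0 : F Z A))); rewrite -pullD !add0r. Qed.

Lemma pullZ Z Z' A (c : hom Z' Z) k (x : F Z A) :
  pull c (k *: x) = k *: pull c x.
Proof. by rewrite -[k *: x]addr0 pull_linear pull0 addr0. Qed.

Lemma push_homD Z A A' (a a' : hom A A') (x : F Z A) :
  push (a + a') x = push a x + push a' x.
Proof. by have := push_linear_hom 1 a a' x; rewrite !scale1r. Qed.

Lemma push_hom0 Z A A' (x : F Z A) : push (0 : hom A A') x = 0.
Proof.
by apply: (addIr (push (0 : hom A A') x)); rewrite -push_homD !add0r.
Qed.

Lemma push_homB Z A A' (a a' : hom A A') (x : F Z A) :
  push (a - a') x = push a x - push a' x.
Proof. by apply: (addIr (push a' x)); rewrite -push_homD !subrK. Qed.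

Lemma pull_homD Z Z' A (c c' : hom Z' Z) (x : F Z A) :
  pull (c + c') x = pull c x + pull c' x.
Proof. by have := pull_linear_hom 1 c c' x; rewrite !scale1r. Qed.

Lemma pull_hom0 Z Z' A (x : F Z A) : pull (0 : hom Z' Z) x = 0.
Proof.
by apply: (addIr (pull (0 : hom Z' Z) x)); rewrite -pull_homD !add0r.
Qed.

Lemma pull_homB Z Z' A (c c' : hom Z' Z) (x : F Z A) :
  pull (c - c') x = pull c x - pull c' x.
Proof. by apply: (addIr (pull c' x)); rewrite -pull_homD !subrK. Qed.

End BimoduleTheory.

Program Definition hom_bimodule (R : comPzRingType) (C : linear_category R) :
    bimodule C :=
  @Bimodule R C (fun Z A => hom Z A)
    (fun Z A A' a x => a \oc x) (fun Z Z' A c x => x \oc c) _ _ _ _ _ _ _ _ _.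
Next Obligation. by move=> * /=; rewrite comp_linear_r. Qed.
Next Obligation. by move=> * /=; rewrite comp_linear_l. Qed.
Next Obligation. by move=> * /=; rewrite comp1m. Qed.
Next Obligation. by move=> * /=; rewrite compA. Qed.
Next Obligation. by move=> * /=; rewrite comp_linear_l. Qed.
Next Obligation. by move=> * /=; rewrite comp_linear_r. Qed.
Next Obligation. by move=> * /=; rewrite compm1. Qed.
Next Obligation. by move=> * /=; rewrite compA. Qed.
Next Obligation. by move=> * /=; rewrite compA. Qed.

(** The coend of [F Z M (x)_R G M A] over [M]: R-linear expressions in the
    symbols [x (x) y], modulo the smallest congruence that makes them an
    R-module, [(x)] R-bilinear, and [m_* x (x) y = x (x) m^* y]. *)
Section Tensor.
Context (R : comPzRingType) (C : linear_category R) (F G : bimodule C).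

Inductive tens_expr (Z A : C) : Type :=
| TZero
| TAdd of tens_expr Z A & tens_expr Z A
| TScale of R & tens_expr Z A
| TPure (M : C) of F Z M & G M A.

Inductive tens_eq (Z A : C) : tens_expr Z A -> tens_expr Z A -> Prop :=
| te_refl s : tens_eq s s
| te_sym s t : tens_eq s t -> tens_eq t s
| te_trans s t u : tens_eq s t -> tens_eq t u -> tens_eq s u
| te_addW s s' t t' :
    tens_eq s s' -> tens_eq t t' -> tens_eq (TAdd s t) (TAdd s' t')
| te_scaleW k s s' : tens_eq s s' -> tens_eq (TScale k s) (TScale k s')
| te_addA s t u : tens_eq (TAdd s (TAdd t u)) (TAdd (TAdd s t) u)
| te_addC s t : tens_eq (TAdd s t) (TAdd t s)
| te_add0 s : tens_eq (TAdd (TZero Z A) s) s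
| te_scaleA k l s : tens_eq (TScale k (TScale l s)) (TScale (k * l) s)
| te_scale0 s : tens_eq (TScale 0 s) (TZero Z A)
| te_scale1 s : tens_eq (TScale 1 s) s
| te_scaleDr k s t :
    tens_eq (TScale k (TAdd s t)) (TAdd (TScale k s) (TScale k t))
| te_scaleDl k l s :
    tens_eq (TScale (k + l) s) (TAdd (TScale k s) (TScale l s))
| te_linear_l M k (x x' : F Z M) (y : G M A) :
    tens_eq (TPure (k *: x + x') y) (TAdd (TScale k (TPure x y)) (TPure x' y))
| te_linear_r M k (x : F Z M) (y y' : G M A) :
    tens_eq (TPure x (k *: y + y')) (TAdd (TScale k (TPure x y)) (TPure x y'))
| te_balanced M M' (m : hom M M') (x : F Z M) (y : G M' A) :
    tens_eq (TPure (push m x) y) (TPure x (pull m y)).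

Definition tens_smodule (Z A : C) : smodule R :=
  @SModule R (tens_expr Z A) (@tens_eq Z A) (TZero Z A) (@TAdd Z A) (@TScale Z A)
    (@te_refl Z A) (@te_sym Z A) (@te_trans Z A) (@te_addW Z A) (@te_scaleW Z A)
    (@te_addA Z A) (@te_addC Z A) (@te_add0 Z A) (@te_scaleA Z A)
    (@te_scale0 Z A) (@te_scale1 Z A) (@te_scaleDr Z A) (@te_scaleDl Z A).

Definition tens_mod (Z A : C) : lmodType R := smodq (tens_smodule Z A).

Definition tens (Z M A : C) (x : F Z M) (y : G M A) : tens_mod Z A :=
  @smpi R (tens_smodule Z A) (TPure x y).

Lemma tens_linear_l Z M A k (x x' : F Z M) (y : G M A) :
  tens (k *: x + x') y = k *: tens x y + tens x' y.
Proof. by rewrite -smpiZ -smpiD; apply/smpiP/te_linear_l. Qed.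

Lemma tens_linear_r Z M A k (x : F Z M) (y y' : G M A) :
  tens x (k *: y + y') = k *: tens x y + tens x y'.
Proof. by rewrite -smpiZ -smpiD; apply/smpiP/te_linear_r. Qed.

Lemma tens_balanced Z M M' A (m : hom M M') (x : F Z M) (y : G M' A) :
  tens (push m x) y = tens x (pull m y).
Proof. exact/smpiP/te_balanced. Qed.

Lemma tens_ind Z A (P : tens_mod Z A -> Prop) :
    P 0 -> (forall s t, P s -> P t -> P (s + t)) ->
    (forall k s, P s -> P (k *: s)) ->
    (forall M (x : F Z M) (y : G M A), P (tens x y)) ->
  forall s, P s.
Proof.
move=> P0 PD PZ Pt; elim/smodq_ind; elim=> [|s Ps t Pu|k s Ps|M x y].
- exact: P0.
- by have := PD _ _ Ps Pu; rewrite -smpiD.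
- by have := PZ k _ Ps; rewrite -smpiZ.
- exact: Pt.
Qed.

Section Lift.
Context (Z A : C) (V : lmodType R) (phi : forall M, F Z M -> G M A -> V).
Hypothesis phi_linear_l : forall M k (x x' : F Z M) (y : G M A),
  phi (k *: x + x') y = k *: phi x y + phi x' y.
Hypothesis phi_linear_r : forall M k (x : F Z M) (y y' : G M A),
  phi x (k *: y + y') = k *: phi x y + phi x y'.
Hypothesis phi_balanced : forall M M' (m : hom M M') (x : F Z M) (y : G M' A),
  phi (push m x) y = phi x (pull m y).

Fixpoint tens_eval (s : tens_expr Z A) : V :=
  match s with
  | TZero => 0
  | TAdd s t => tens_eval s + tens_eval t
  | TScale k s => k *: tens_eval s
  | TPure M x y => phi x y
  end.

Lemma tens_evalP s t : tens_eq s t -> tens_eval s = tens_eval t.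
Proof.
elim=> //= *.
- by etransitivity; eassumption.
- by congr (_ + _).
- by congr (_ *: _).
- by rewrite addrA.
- by rewrite addrC.
- by rewrite add0r.
- by rewrite scalerA.
- by rewrite scale0r.
- by rewrite scale1r.
- by rewrite scalerDr.
- by rewrite scalerDl.
Qed.

Definition tens_lift (u : tens_mod Z A) : V :=
  tens_eval (@smrepr R (tens_smodule Z A) u).

Lemma tens_lift_pi s :
  tens_lift (@smpi R (tens_smodule Z A) s) = tens_eval s.
Proof. exact/tens_evalP/(@smrepr_pi R (tens_smodule Z A)). Qed.

Lemma tens_liftE M (x : F Z M) (y : G M A) : tens_lift (tens x y) = phi x y.
Proof. exact: tens_lift_pi. Qed.

Lemma tens_lift_linear k u v :
  tens_lift (k *: u + v) = k *: tens_lift u + tens_lift v.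
Proof.
elim/smodq_ind: u => s; elim/smodq_ind: v => t.
by rewrite -smpiZ -smpiD !tens_lift_pi.
Qed.

Lemma tens_lift_unique (f : tens_mod Z A -> V) :
    (forall k u v, f (k *: u + v) = k *: f u + f v) ->
    (forall M (x : F Z M) (y : G M A), f (tens x y) = phi x y) ->
  forall u, f u = tens_lift u.
Proof.
move=> flin ft; have f0 : f 0 = 0.
  by have := flin 1 0 0; rewrite !scale1r addr0 -[LHS]addr0 => /addrI.
have lin0 : tens_lift 0 = 0 by exact: tens_lift_pi.
elim/tens_ind=> [|s t IHs IHt|k s IHs|M x y].
- by rewrite f0 lin0.
- by rewrite -[s]scale1r flin tens_lift_linear IHs IHt.
- by rewrite -[k *: s]addr0 flin tens_lift_linear f0 lin0 IHs.
- by rewrite ft tens_liftE.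
Qed.

End Lift.

Definition tens_push Z A A' (a : hom A A') : tens_mod Z A -> tens_mod Z A' :=
  tens_lift (fun M (x : F Z M) (y : G M A) => tens x (push a y)).

Definition tens_pull Z Z' A (c : hom Z' Z) : tens_mod Z A -> tens_mod Z' A :=
  tens_lift (fun M (x : F Z M) (y : G M A) => tens (pull c x) y).

Lemma tens_pushE Z M A A' (a : hom A A') (x : F Z M) (y : G M A) :
  tens_push a (tens x y) = tens x (push a y).
Proof.
apply: (@tens_liftE Z A _ (fun M (x : F Z M) (y : G M A) => tens x (push a y))).
- by move=> *; rewrite tens_linear_l.
- by move=> *; rewrite push_linear tens_linear_r.
- by move=> *; rewrite tens_balanced push_pull.
Qed.

Lemma tens_push_linear Z A A' (a : hom A A') k (u v : tens_mod Z A) :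
  tens_push a (k *: u + v) = k *: tens_push a u + tens_push a v.
Proof.
apply: tens_lift_linear.
- by move=> *; rewrite tens_linear_l.
- by move=> *; rewrite push_linear tens_linear_r.
- by move=> *; rewrite tens_balanced push_pull.
Qed.

Lemma tens_pullE Z Z' M A (c : hom Z' Z) (x : F Z M) (y : G M A) :
  tens_pull c (tens x y) = tens (pull c x) y.
Proof.
apply: (@tens_liftE Z A _ (fun M (x : F Z M) (y : G M A) => tens (pull c x) y)).
- by move=> *; rewrite pull_linear tens_linear_l.
- by move=> *; rewrite tens_linear_r.
- by move=> *; rewrite -push_pull tens_balanced.
Qed.

Lemma tens_pull_linear Z Z' A (c : hom Z' Z) k (u v : tens_mod Z A) :
  tens_pull c (k *: u + v) = k *: tens_pull c u + tens_pull c v.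
Proof.
apply: tens_lift_linear.
- by move=> *; rewrite pull_linear tens_linear_l.
- by move=> *; rewrite tens_linear_r.
- by move=> *; rewrite -push_pull tens_balanced.
Qed.

Lemma tens_ext Z A (V : lmodType R) (f g : tens_mod Z A -> V) :
    (forall k u v, f (k *: u + v) = k *: f u + f v) ->
    (forall k u v, g (k *: u + v) = k *: g u + g v) ->
    (forall M (x : F Z M) (y : G M A), f (tens x y) = g (tens x y)) ->
  forall u, f u = g u.
Proof.
move=> flin glin fg.
have l0 (h : tens_mod Z A -> V) :
    (forall k u v, h (k *: u + v) = k *: h u + h v) -> h 0 = 0.
  by move=> hlin; have := hlin 1 0 0; rewrite !scale1r addr0 -[LHS]addr0 => /addrI.
elim/tens_ind=> [|s t IHs IHt|k s IHs|M x y].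
- by rewrite !l0.
- by rewrite -[s]scale1r flin glin IHs IHt.
- by rewrite -[k *: s]addr0 flin glin IHs !l0.
- exact: fg.
Qed.

Program Definition tens_bimodule : bimodule C :=
  @Bimodule R C tens_mod tens_push tens_pull
    tens_push_linear _ _ _ tens_pull_linear _ _ _ _.
Next Obligation.
move=> Z A A' k a a'; apply: tens_ext.
- exact: tens_push_linear.
- move=> l u v; rewrite !tens_push_linear !scalerDr !scalerA mulrC.
  by rewrite addrACA.
- by move=> M x y; rewrite !tens_pushE push_linear_hom tens_linear_r.
Qed.
Next Obligation.
move=> Z A; apply: tens_ext => //; first exact: tens_push_linear.
by move=> M x y; rewrite tens_pushE push_id.
Qed.
Next Obligation.
move=> Z A A' A'' a' a; apply: tens_ext.
- exact: tens_push_linear.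
- by move=> k u v; rewrite !tens_push_linear.
- by move=> M x y; rewrite !tens_pushE push_comp.
Qed.
Next Obligation.
move=> Z Z' A k c c'; apply: tens_ext.
- exact: tens_pull_linear.
- move=> l u v; rewrite !tens_pull_linear !scalerDr !scalerA mulrC.
  by rewrite addrACA.
- by move=> M x y; rewrite !tens_pullE pull_linear_hom tens_linear_l.
Qed.
Next Obligation.
move=> Z A; apply: tens_ext => //; first exact: tens_pull_linear.
by move=> M x y; rewrite tens_pullE pull_id.
Qed.
Next Obligation.
move=> Z Z' Z'' A c c'; apply: tens_ext.
- exact: tens_pull_linear.
- by move=> k u v; rewrite !tens_pull_linear.
- by move=> M x y; rewrite !tens_pullE pull_comp.
Qed.
Next Obligation.
move=> Z Z' A A' a c; apply: tens_ext.
- by move=> k u v; rewrite !tens_pull_linear !tens_push_linear.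
- by move=> k u v; rewrite !tens_push_linear !tens_pull_linear.
- by move=> M x y; rewrite tens_pullE !tens_pushE tens_pullE.
Qed.

End Tensor.

(** [tens_power E i] is the [i]-fold tensor power of [E] over [C], the empty
    power being the bimodule [hom]. *)
Fixpoint tens_power (R : comPzRingType) (C : linear_category R)
    (E : bimodule C) (i : nat) : bimodule C :=
  match i with
  | 0 => hom_bimodule C
  | 1 => E
  | j.+1 => tens_bimodule (tens_power E j) E
  end.

Definition seq_equiv (R : comPzRingType) (C : linear_category R) (A B B' D : C)
    (x : hom A B) (y : hom B D) (x' : hom A B') (y' : hom B' D) : Prop :=
  exists b : hom B B', [/\ is_iso b, b \oc x = x' & y' \oc b = y].

Definition sum_mor (R : comPzRingType) (C : additive_category R)
    (A A' B B' : C) (f : hom A B) (f' : hom A' B') :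
    hom (sum_ob A A') (sum_ob B B') :=
  bin1 (sum_obP B B') \oc f \oc bpr1 (sum_obP A A') +
  bin2 (sum_obP B B') \oc f' \oc bpr2 (sum_obP A A').

Definition sum_ext (R : comPzRingType) (C : additive_category R)
    (E : bimodule C) (A A' D D' : C) (d : E D A) (d' : E D' A') :
    E (sum_ob D D') (sum_ob A A') :=
  push (bin1 (sum_obP A A')) (pull (bpr1 (sum_obP D D')) d) +
  push (bin2 (sum_obP A A')) (pull (bpr2 (sum_obP D D')) d').

(** Extriangulated categories in the sense of Nakaoka--Palu. [realizes x y d]
    says that the sequence [A --x--> B --y--> D] belongs to the equivalence
    class [s(d)]; [real_ex], [real_unique] and [real_equiv] say that [s(d)] is
    exactly one class, and [real_mor], [real_split], [real_sum] that [s] is an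
    additive realization (axiom ET2). *)
Record extriangulated_category (R : comPzRingType) := ExtriangulatedCategory {
  ext_cat :> additive_category R;
  Ext : bimodule ext_cat;
  realizes : forall A B D : ext_cat,
    hom A B -> hom B D -> Ext D A -> Prop;

  real_ex : forall (A D : ext_cat) (d : Ext D A),
    exists (B : ext_cat) (x : hom A B) (y : hom B D), realizes x y d;
  real_unique : forall (A B B' D : ext_cat) (d : Ext D A)
      (x : hom A B) (y : hom B D) (x' : hom A B') (y' : hom B' D),
    realizes x y d -> realizes x' y' d -> seq_equiv x y x' y';
  real_equiv : forall (A B B' D : ext_cat) (d : Ext D A)
      (x : hom A B) (y : hom B D) (x' : hom A B') (y' : hom B' D),
    realizes x y d -> seq_equiv x y x' y' -> realizes x' y' d;

  real_mor : forall (A B D A' B' D' : ext_cat)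
      (x : hom A B) (y : hom B D) (d : Ext D A)
      (x' : hom A' B') (y' : hom B' D') (d' : Ext D' A')
      (a : hom A A') (c : hom D D'),
    realizes x y d -> realizes x' y' d' -> push a d = pull c d' ->
    exists b : hom B B', b \oc x = x' \oc a /\ y' \oc b = c \oc y;
  real_split : forall A D : ext_cat,
    realizes (bin1 (sum_obP A D)) (bpr2 (sum_obP A D)) 0;
  real_sum : forall (A B D A' B' D' : ext_cat)
      (x : hom A B) (y : hom B D) (d : Ext D A)
      (x' : hom A' B') (y' : hom B' D') (d' : Ext D' A'),
    realizes x y d -> realizes x' y' d' ->
    realizes (sum_mor x x') (sum_mor y y') (sum_ext d d');

  et3 : forall (A B D A' B' D' : ext_cat)
      (x : hom A B) (y : hom B D) (d : Ext D A)
      (x' : hom A' B') (y' : hom B' D') (d' : Ext D' A')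
      (a : hom A A') (b : hom B B'),
    realizes x y d -> realizes x' y' d' -> b \oc x = x' \oc a ->
    exists c : hom D D', c \oc y = y' \oc b /\ push a d = pull c d';
  et3_op : forall (A B D A' B' D' : ext_cat)
      (x : hom A B) (y : hom B D) (d : Ext D A)
      (x' : hom A' B') (y' : hom B' D') (d' : Ext D' A')
      (b : hom B B') (c : hom D D'),
    realizes x y d -> realizes x' y' d' -> c \oc y = y' \oc b ->
    exists a : hom A A', b \oc x = x' \oc a /\ push a d = pull c d';

  et4 : forall (A B D K F : ext_cat)
      (f : hom A B) (f' : hom B D) (d : Ext D A)
      (g : hom B K) (g' : hom K F) (d' : Ext F B),
    realizes f f' d -> realizes g g' d' ->
    exists (H : ext_cat) (h' : hom K H) (p : hom D H) (q : hom H F)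
        (d'' : Ext H A),
      [/\ realizes (g \oc f) h' d'',
          h' \oc g = p \oc f' /\ q \oc h' = g',
          realizes p q (push f' d'),
          pull p d'' = d
        & push f d'' = pull q d'];
  et4_op : forall (D A B F K : ext_cat)
      (f' : hom D A) (f : hom A B) (d : Ext B D)
      (g' : hom F B) (g : hom B K) (d' : Ext K F),
    realizes f' f d -> realizes g' g d' ->
    exists (H : ext_cat) (h' : hom H A) (p : hom D H) (q : hom H F)
        (d'' : Ext K H),
      [/\ realizes h' (g \oc f) d'',
          h' \oc p = f' /\ f \oc h' = g' \oc q,
          realizes p q (pull g' d),
          push q d'' = d'
        & push p d = pull g d''] }.

Arguments Ext {R C} : rename.
Arguments realizes {R C A B D} x y d : rename.

Definition hExt (R : comPzRingType) (C : extriangulated_category R) (i : nat) :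
  bimodule C := tens_power (@Ext R C) i.

(** Full subcategories [X] with [X = add X]. *)
Record add_subcategory (R : comPzRingType) (C : additive_category R) :=
  AddSubcategory {
  sub_mem :> C -> Prop;
  sub_iso : forall (A B : C) (f : hom A B), is_iso f -> sub_mem A -> sub_mem B;
  sub_zero : sub_mem (zero_ob C);
  sub_sum : forall A B P : C,
    biproduct A B P -> sub_mem A -> sub_mem B -> sub_mem P;
  sub_summand : forall A B P : C, biproduct A B P -> sub_mem P -> sub_mem A }.

Section Subcategories.
Context (R : comPzRingType) (C : extriangulated_category R).
Implicit Types (X : add_subcategory C) (A : C).

Definition rigid (n : nat) X : Prop :=
  forall i, (1 <= i <= n)%N ->
  forall A B : C, X A -> X B -> forall e : hExt C i A B, e = 0.

Definition left_perp (i : nat) X A : Prop :=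
  forall B : C, X B -> forall e : hExt C i A B, e = 0.

Definition right_perp (i : nat) X A : Prop :=
  forall B : C, X B -> forall e : hExt C i B A, e = 0.

Definition left_approximation X A (B : C) (x : hom A B) : Prop :=
  X B /\ forall (B' : C) (f : hom A B'), X B' -> exists g : hom B B', f = g \oc x.

Definition right_approximation X A (B : C) (y : hom B A) : Prop :=
  X B /\ forall (B' : C) (f : hom B' A), X B' -> exists g : hom B' B, f = y \oc g.

Record left_app_triangle X A := LeftAppTriangle {
  la_mid : C;
  la_plus : C;
  la_x : hom A la_mid;
  la_y : hom la_mid la_plus;
  la_ext : Ext la_plus A;
  la_real : realizes la_x la_y la_ext;
  la_app : left_approximation X la_x }.

Record right_app_triangle X A := RightAppTriangle {
  ra_minus : C;
  ra_mid : C;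
  ra_x : hom ra_minus ra_mid;
  ra_y : hom ra_mid A;
  ra_ext : Ext A ra_minus;
  ra_real : realizes ra_x ra_y ra_ext;
  ra_app : right_approximation X ra_y }.

Definition strongly_covariantly_finite X : Prop :=
  forall A, inhabited (left_app_triangle X A).

Definition strongly_contravariantly_finite X : Prop :=
  forall A, inhabited (right_app_triangle X A).

Definition strongly_functorially_finite X : Prop :=
  strongly_covariantly_finite X /\ strongly_contravariantly_finite X.

End Subcategories.

Section IdealQuotient.
Context (R : comPzRingType) (C : additive_category R) (X : add_subcategory C).
Implicit Types (A B D : C).

Definition factors_through A B (f : hom A B) : Prop :=
  exists (M : C) (u : hom A M) (v : hom M B), X M /\ f = v \oc u.

Lemma factors_0 A B : factors_through (0 : hom A B).
Proof.
by exists (zero_ob C), 0, 0; split; [exact: sub_zero | rewrite compm0].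
Qed.

Lemma factors_D A B (f g : hom A B) :
  factors_through f -> factors_through g -> factors_through (f + g).
Proof.
move=> [M [u [v [XM ->]]]] [N [u' [v' [XN ->]]]].
have b := sum_obP M N.
exists (sum_ob M N), (bin1 b \oc u + bin2 b \oc u'), (v \oc bpr1 b + v' \oc bpr2 b).
split; first exact: (sub_sum b).
rewrite compDl !compDr -!compA !(compA (bpr1 b)) !(compA (bpr2 b)).
by rewrite bpr1_in1 bpr2_in2 bpr1_in2 bpr2_in1 !comp1m !comp0m !compm0 addr0 add0r.
Qed.

Lemma factors_Z A B k (f : hom A B) :
  factors_through f -> factors_through (k *: f).
Proof.
by move=> [M [u [v [XM ->]]]]; exists M, u, (k *: v); rewrite compZl.
Qed.

Lemma factors_compl A B D (g : hom B D) (f : hom A B) :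
  factors_through f -> factors_through (g \oc f).
Proof.
by move=> [M [u [v [XM ->]]]]; exists M, u, (g \oc v); rewrite compA.
Qed.

Lemma factors_compr A B D (g : hom B D) (f : hom A B) :
  factors_through g -> factors_through (g \oc f).
Proof.
by move=> [M [u [v [XM ->]]]]; exists M, (u \oc f), v; rewrite compA.
Qed.

Lemma factors_N A B (f : hom A B) : factors_through f -> factors_through (- f).
Proof. by rewrite -scaleN1r; apply: factors_Z. Qed.

Program Definition ideal_smodule A B : smodule R :=
  @SModule R (hom A B) (fun f g => factors_through (f - g)) 0
    (fun f g => f + g) (fun k f => k *: f) _ _ _ _ _ _ _ _ _ _ _ _ _.
Next Obligation. by move=> * /=; rewrite subrr; apply: factors_0. Qed.
Next Obligation. by move=> A B f g /= fg; rewrite -opprB; apply: factors_N. Qed.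
Next Obligation.
by move=> A B f g h /= fg gh; rewrite -(subrKA g); apply: factors_D.
Qed.
Next Obligation.
by move=> A B f f' g g' /= ff gg; rewrite opprD addrACA; apply: factors_D.
Qed.
Next Obligation. by move=> A B k f g /= fg; rewrite -scalerBr; apply: factors_Z. Qed.
Next Obligation. by move=> * /=; rewrite addrA subrr; apply: factors_0. Qed.
Next Obligation. by move=> A B f g /=; rewrite [f + g]addrC subrr; apply: factors_0. Qed.
Next Obligation. by move=> * /=; rewrite add0r subrr; apply: factors_0. Qed.
Next Obligation. by move=> * /=; rewrite scalerA subrr; apply: factors_0. Qed.
Next Obligation. by move=> * /=; rewrite scale0r subrr; apply: factors_0. Qed.
Next Obligation. by move=> * /=; rewrite scale1r subrr; apply: factors_0. Qed.
Next Obligation. by move=> * /=; rewrite scalerDr subrr; apply: factors_0. Qed.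
Next Obligation. by move=> * /=; rewrite scalerDl subrr; apply: factors_0. Qed.

Definition quot_hom A B : lmodType R := smodq (ideal_smodule A B).

Definition quot_mor A B (f : hom A B) : quot_hom A B :=
  @smpi R (ideal_smodule A B) f.

Definition quot_rep A B (u : quot_hom A B) : hom A B :=
  @smrepr R (ideal_smodule A B) u.

Lemma quot_morP A B (f g : hom A B) :
  quot_mor f = quot_mor g <-> factors_through (f - g).
Proof. exact: smpiP. Qed.

Lemma quot_repK A B (u : quot_hom A B) : quot_mor (quot_rep u) = u.
Proof. exact: smreprK. Qed.

Lemma quot_mor_linear A B k (f g : hom A B) :
  quot_mor (k *: f + g) = k *: quot_mor f + quot_mor g.
Proof. by rewrite -smpiZ -smpiD. Qed.

Lemma quot_ind A B (P : quot_hom A B -> Prop) :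
  (forall f, P (quot_mor f)) -> forall u, P u.
Proof. by move=> Pf u; rewrite -(quot_repK u). Qed.

Definition quot_comp A B D (v : quot_hom B D) (u : quot_hom A B) :
  quot_hom A D := quot_mor (quot_rep v \oc quot_rep u).

Lemma quot_compE A B D (g : hom B D) (f : hom A B) :
  quot_comp (quot_mor g) (quot_mor f) = quot_mor (g \oc f).
Proof.
apply/quot_morP; set g' := quot_rep _; set f' := quot_rep _.
rewrite -(subrKA (g' \oc f)) -compBr -compBl.
apply: factors_D; [apply: factors_compl | apply: factors_compr].
- by apply/quot_morP; rewrite quot_repK.
- by apply/quot_morP; rewrite quot_repK.
Qed.

Program Definition quot_linear : linear_category R :=
  @LinearCategory R C quot_hom (fun A => quot_mor (idm A)) quot_comp _ _ _ _ _.
Next Obligation.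
move=> A B D F; elim/quot_ind=> h; elim/quot_ind=> g; elim/quot_ind=> f.
by rewrite !quot_compE compA.
Qed.
Next Obligation.
by move=> A B; elim/quot_ind=> f; rewrite quot_compE comp1m.
Qed.
Next Obligation.
by move=> A B; elim/quot_ind=> f; rewrite quot_compE compm1.
Qed.
Next Obligation.
move=> A B D k; elim/quot_ind=> g; elim/quot_ind=> g'; elim/quot_ind=> f.
by rewrite -quot_mor_linear !quot_compE comp_linear_l quot_mor_linear.
Qed.
Next Obligation.
move=> A B D k; elim/quot_ind=> g; elim/quot_ind=> f; elim/quot_ind=> f'.
by rewrite -quot_mor_linear !quot_compE comp_linear_r quot_mor_linear.
Qed.

Program Definition quot_biproduct A B : @biproduct R quot_linear A B (sum_ob A B) :=
  let b := sum_obP A B in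
  @Biproduct R quot_linear A B (sum_ob A B) (quot_mor (bin1 b))
    (quot_mor (bin2 b)) (quot_mor (bpr1 b)) (quot_mor (bpr2 b)) _ _ _ _ _.
Next Obligation. by move=> A B; rewrite /= quot_compE bpr1_in1. Qed.
Next Obligation. by move=> A B; rewrite /= quot_compE bpr2_in2. Qed.
Next Obligation. by move=> A B; rewrite /= quot_compE bpr1_in2. Qed.
Next Obligation. by move=> A B; rewrite /= quot_compE bpr2_in1. Qed.
Next Obligation. by move=> A B; rewrite /= !quot_compE -smpiD /= bin_pr. Qed.

Program Definition ideal_quotient : additive_category R :=
  @AdditiveCategory R quot_linear (zero_ob C) _ (@sum_ob R C) quot_biproduct.
Next Obligation. by rewrite /= zero_obP. Qed.

Definition quot_functor : functor C ideal_quotient :=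
  @Functor R C ideal_quotient (fun A => A) quot_mor (fun A => erefl)
    (fun A B D g f => esym (quot_compE g f)).

End IdealQuotient.

Arguments quot_functor {R C} X.

Section SuspensionLoop.
Context (R : comPzRingType) (C : extriangulated_category R).

Record triangle_mor (A B D A' B' D' : C)
    (x : hom A B) (y : hom B D) (d : Ext D A)
    (x' : hom A' B') (y' : hom B' D') (d' : Ext D' A')
    (f : hom A A') (g : hom B B') (h : hom D D') : Prop := TriangleMor {
  tm_x : g \oc x = x' \oc f;
  tm_y : h \oc y = y' \oc g;
  tm_ext : push f d = pull h d' }.

Lemma triangle_push0 (A B D : C) (x : hom A B) (y : hom B D) (d : Ext D A) :
  realizes x y d -> push x d = 0.
Proof.
move=> r; have b := sum_obP B (zero_ob C).
have z (M : C) (v : hom (zero_ob C) M) : v = 0.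
  by rewrite -[v]compm1 zero_obP compm0.
have r0 : realizes (idm B) (0 : hom B (zero_ob C)) 0.
  have rs := real_split B (zero_ob C).
  apply: (real_equiv rs); exists (bpr1 (sum_obP B (zero_ob C))).
  split; last 1 first.
  - by rewrite comp0m -[RHS]comp1m zero_obP comp0m.
  - exists (bin1 (sum_obP B (zero_ob C))); split; last exact: bpr1_in1.
    by rewrite -[RHS](bin_pr (sum_obP B (zero_ob C))) (z _ (bin2 _)) comp0m addr0.
  - exact: bpr1_in1.
have [//|c [_ ->]] := et3 (a := x) (b := idm B) r r0.
by rewrite pull0.
Qed.

Lemma triangle_pull0 (A B D : C) (x : hom A B) (y : hom B D) (d : Ext D A) :
  realizes x y d -> pull y d = 0.
Proof.
move=> r; have z (M : C) (v : hom M (zero_ob C)) : v = 0.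
  by rewrite -[v]comp1m zero_obP comp0m.
have r0 : realizes (0 : hom (zero_ob C) B) (idm B) 0.
  have rs := real_split (zero_ob C) B.
  apply: (real_equiv rs); exists (bpr2 (sum_obP (zero_ob C) B)).
  split; last 1 first.
  - by rewrite comp1m.
  - exists (bin2 (sum_obP (zero_ob C) B)); split; last exact: bpr2_in2.
    by rewrite -[RHS](bin_pr (sum_obP (zero_ob C) B)) (z _ (bpr1 _)) compm0 add0r.
  - exact: bpr2_in1.
have [//|a [_]] := et3_op (b := idm B) (c := y) r0 r.
by rewrite push0 => ->.
Qed.

Lemma triangle_pull_lift (A B D M : C) (x : hom A B) (y : hom B D)
    (d : Ext D A) (h : hom M D) :
  realizes x y d -> pull h d = 0 -> exists k : hom M B, h = y \oc k.
Proof.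
move=> r hd; have rs := real_split A M.
have [|b [_ eb]] := real_mor (a := idm A) (c := h) rs r.
  by rewrite push_id hd.
by exists (b \oc bin2 (sum_obP A M)); rewrite compA eb -compA bpr2_in2 compm1.
Qed.

Lemma triangle_push_lift (A B D M : C) (x : hom A B) (y : hom B D)
    (d : Ext D A) (h : hom A M) :
  realizes x y d -> push h d = 0 -> exists k : hom B M, h = k \oc x.
Proof.
move=> r hd; have rs := real_split M D.
have [|b [eb _]] := real_mor (a := h) (c := idm D) r rs.
  by rewrite pull_id hd.
by exists (bpr1 (sum_obP M D) \oc b); rewrite -compA eb compA bpr1_in1 comp1m.
Qed.

Section Suspension.
Context (X : add_subcategory C) (L : forall A : C, left_app_triangle X A).

Definition susp_mor (A B : C) (f : hom A B) (g : hom (la_mid (L A)) (la_mid (L B)))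
    (h : hom (la_plus (L A)) (la_plus (L B))) : Prop :=
  triangle_mor (la_x (L A)) (la_y (L A)) (la_ext (L A))
               (la_x (L B)) (la_y (L B)) (la_ext (L B)) f g h.

Lemma susp_ex (A B : C) (f : hom A B) : exists h, exists g, susp_mor f g h.
Proof.
have [_ appA] := la_app (L A); have [XB _] := la_app (L B).
have [g eg] := appA _ (la_x (L B) \oc f) XB.
have [h [eh ed]] := et3 (la_real (L A)) (la_real (L B)) (esym eg).
by exists h, g.
Qed.

Definition susp_fun (A B : C) (f : hom A B) :
  hom (la_plus (L A)) (la_plus (L B)) := projT1 (cid (susp_ex f)).

Lemma susp_wd (A B : C) (f f' : hom A B) g g' h h' :
    susp_mor f g h -> susp_mor f' g' h' -> factors_through X (f - f') ->
  factors_through X (h - h').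
Proof.
move=> [_ _ e] [_ _ e'] [M [u [v [XM fE]]]].
have [_ /(_ M u XM) [t ut]] := la_app (L A); have [XB _] := la_app (L B).
have [|k ->] := triangle_pull_lift (h := h - h') (la_real (L B)).
  rewrite pull_homB -e -e' -push_homB fE ut compA push_comp.
  by rewrite (triangle_push0 (la_real (L A))) push0.
by exists (la_mid (L B)), k, (la_y (L B)).
Qed.

Definition susp_fmor (A B : ideal_quotient X) (u : hom A B) :
  @hom R (ideal_quotient X) (la_plus (L A)) (la_plus (L B)) :=
  fmor (quot_functor X) (susp_fun (quot_rep u)).

Lemma susp_fmorE (A B : C) (f : hom A B) g h :
  susp_mor f g h ->
  susp_fmor (fmor (quot_functor X) f) = fmor (quot_functor X) h.
Proof.
move=> m; rewrite /susp_fmor /susp_fun; case: cid => h' [g' m'] /=.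
by apply/quot_morP/(susp_wd m' m)/quot_morP; rewrite quot_repK.
Qed.

Lemma susp_fmor_id (A : ideal_quotient X) :
  susp_fmor (idm A) = @idm R (ideal_quotient X) (la_plus (L A)).
Proof.
rewrite -[idm A](fmor_id (quot_functor X)) (@susp_fmorE _ _ _ (idm _) (idm _)) //.
by split; rewrite ?comp1m ?compm1 // push_id pull_id.
Qed.

Lemma susp_fmor_comp (A B D : ideal_quotient X) (v : hom B D) (u : hom A B) :
  susp_fmor (v \oc u) = susp_fmor v \oc susp_fmor u.
Proof.
elim/quot_ind: v => v; elim/quot_ind: u => u.
have [h [g m]] := susp_ex u; have [h' [g' m']] := susp_ex v.
transitivity (susp_fmor (fmor (quot_functor X) (v \oc u))).
  by congr susp_fmor; apply: quot_compE.
rewrite (susp_fmorE m) (susp_fmorE m').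
transitivity (fmor (quot_functor X) (h' \oc h)); last exact/esym/quot_compE.
apply: (@susp_fmorE _ _ _ (g' \oc g)).
case: m m' => [mx my me] [mx' my' me']; split.
- by rewrite -compA mx compA mx' -compA.
- by rewrite -compA my compA my' -compA.
- by rewrite push_comp me push_pull me' pull_comp.
Qed.

Definition suspension : functor (ideal_quotient X) (ideal_quotient X) :=
  @Functor R (ideal_quotient X) (ideal_quotient X) (fun A => la_plus (L A))
    susp_fmor susp_fmor_id susp_fmor_comp.

(** [susp_fmor] uses arbitrary choices; [suspension] nevertheless sends the
    class of [f] to the class of [h] for every completion of [f] to a morphism
    [(f, g, h)] of the chosen triangles. *)
Lemma suspensionE (A B : C) (f : hom A B) g h :
  susp_mor f g h ->
  fmor suspension (fmor (quot_functor X) f) = fmor (quot_functor X) h.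
Proof. exact: susp_fmorE. Qed.

End Suspension.

Section Loop.
Context (X : add_subcategory C) (L : forall A : C, right_app_triangle X A).

Definition loop_mor (A B : C) (h : hom (ra_minus (L A)) (ra_minus (L B)))
    (g : hom (ra_mid (L A)) (ra_mid (L B))) (f : hom A B) : Prop :=
  triangle_mor (ra_x (L A)) (ra_y (L A)) (ra_ext (L A))
               (ra_x (L B)) (ra_y (L B)) (ra_ext (L B)) h g f.

Lemma loop_ex (A B : C) (f : hom A B) : exists h, exists g, loop_mor h g f.
Proof.
have [XA _] := ra_app (L A); have [_ appB] := ra_app (L B).
have [g eg] := appB _ (f \oc ra_y (L A)) XA.
have [h [eh ed]] := et3_op (ra_real (L A)) (ra_real (L B)) eg.
by exists h, g.
Qed.

Definition loop_fun (A B : C) (f : hom A B) :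
  hom (ra_minus (L A)) (ra_minus (L B)) := projT1 (cid (loop_ex f)).

Lemma loop_wd (A B : C) (f f' : hom A B) g g' h h' :
    loop_mor h g f -> loop_mor h' g' f' -> factors_through X (f - f') ->
  factors_through X (h - h').
Proof.
move=> [_ _ e] [_ _ e'] [M [u [v [XM fE]]]].
have [_ /(_ M v XM) [t vt]] := ra_app (L B); have [XA _] := ra_app (L A).
have [|k ->] := triangle_push_lift (h := h - h') (ra_real (L A)).
  rewrite push_homB e e' -pull_homB fE vt -compA pull_comp.
  by rewrite (triangle_pull0 (ra_real (L B))) pull0.
by exists (ra_mid (L A)), (ra_x (L A)), k.
Qed.

Definition loop_fmor (A B : ideal_quotient X) (u : hom A B) :
  @hom R (ideal_quotient X) (ra_minus (L A)) (ra_minus (L B)) :=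
  fmor (quot_functor X) (loop_fun (quot_rep u)).

Lemma loop_fmorE (A B : C) (f : hom A B) g h :
  loop_mor h g f ->
  loop_fmor (fmor (quot_functor X) f) = fmor (quot_functor X) h.
Proof.
move=> m; rewrite /loop_fmor /loop_fun; case: cid => h' [g' m'] /=.
by apply/quot_morP/(loop_wd m' m)/quot_morP; rewrite quot_repK.
Qed.

Lemma loop_fmor_id (A : ideal_quotient X) :
  loop_fmor (idm A) = @idm R (ideal_quotient X) (ra_minus (L A)).
Proof.
rewrite -[idm A](fmor_id (quot_functor X)) (@loop_fmorE _ _ _ (idm _) (idm _)) //.
by split; rewrite ?comp1m ?compm1 // push_id pull_id.
Qed.

Lemma loop_fmor_comp (A B D : ideal_quotient X) (v : hom B D) (u : hom A B) :
  loop_fmor (v \oc u) = loop_fmor v \oc loop_fmor u.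
Proof.
elim/quot_ind: v => v; elim/quot_ind: u => u.
have [h [g m]] := loop_ex u; have [h' [g' m']] := loop_ex v.
transitivity (loop_fmor (fmor (quot_functor X) (v \oc u))).
  by congr loop_fmor; apply: quot_compE.
rewrite (loop_fmorE m) (loop_fmorE m').
transitivity (fmor (quot_functor X) (h' \oc h)); last exact/esym/quot_compE.
apply: (@loop_fmorE _ _ _ (g' \oc g)).
case: m m' => [mx my me] [mx' my' me']; split.
- by rewrite -compA mx compA mx' -compA.
- by rewrite -compA my compA my' -compA.
- by rewrite push_comp me push_pull me' pull_comp.
Qed.

Definition loop : functor (ideal_quotient X) (ideal_quotient X) :=
  @Functor R (ideal_quotient X) (ideal_quotient X) (fun A => ra_minus (L A))
    loop_fmor loop_fmor_id loop_fmor_comp.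

(** [loop_fmor] uses arbitrary choices; [loop] nevertheless sends the class of
    [f] to the class of [h] for every completion of [f] to a morphism
    [(h, g, f)] of the chosen triangles. *)
Lemma loopE (A B : C) (f : hom A B) g h :
  loop_mor h g f ->
  fmor loop (fmor (quot_functor X) f) = fmor (quot_functor X) h.
Proof. exact: loop_fmorE. Qed.

End Loop.

End SuspensionLoop.

(* Main.v *)
From mathcomp Require Import all_boot all_order all_algebra.
Require Import Defs.

(** Objects of [X] are the zero objects of the ideal quotient, so the [n]-fold
    suspension is the zero functor exactly when the [n]-fold [A^+...+] is in [X]
    for every [A], and similarly for the loop and [A^-...-]. Write (S) and (O)
    for these two assertions, and (r), (l) for the assertions that every object
    orthogonal to [X] in degrees 1 to [n], on the right respectively on the
    left, is in [X]; that objects of [X] are themselves orthogonal to [X] is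
    rigidity.

    (S) implies (O), by the adjunction: morphisms [A^+ -> B] all factor through
    [X] only if morphisms [A -> B^-] all do ([adjoint_factors]), and after [n]
    steps the identity of the [n]-fold loop of [A] factors through [X]
    ([susp_loop_mem]).

    (r) implies (O): in the long exact sequence of [A^- -> X^A -> A], rigidity
    makes the extensions from [X] to [A^-] vanish in one degree more than those
    to [A], so the [n]-fold loop of any object is right orthogonal to [X]
    ([loop_ob_mem]).

    (S) implies (r): conversely, if [A] is right orthogonal to [X] in degrees 1
    to [k.+1], then [A^+] is so in degrees 1 to [k]; and if also [A^+] is in
    [X], the triangle [A -> X_A -> A^+] splits and [A] is in [X]. Descending
    from the [n]-fold suspension, [A] is in [X] ([susp_ob_mem_perp]).

    The same three implications in the opposite category read: (O) implies (S),
    (l) implies (S), and (O) implies (l). Together they give the theorem.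

    Two things remain. First, exactness of the higher extensions in the
    covariant variable, which reduces to a criterion for a pure tensor
    [v (x) y] to vanish ([tens_eq0_lifts]). Second, the passage to the opposite
    category, whose tensor powers of [Ext] must be compared with those of [C];
    this is where the associativity of the tensor product is used
    ([op_tens_power_iso]). *)

Set Implicit Arguments.
Unset Strict Implicit.
Unset Printing Implicit Defensive.

Import GRing.Theory.
Local Open Scope ring_scope.
#[local] Obligation Tactic := idtac.

(** * Exactness of the higher extensions in the covariant variable *)

Section PureTensors.
Context (R : comPzRingType) (C : additive_category R).
Implicit Types (F G : bimodule C) (Z A M : C).

Lemma tens0l F G Z M A (y : G M A) : tens (0 : F Z M) y = 0.
Proof.
apply: (addrI (tens (0 : F Z M) y)); rewrite addr0.
by have := tens_linear_l 1 (0 : F Z M) 0 y; rewrite !scale1r addr0 => <-.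
Qed.

Lemma tensDl F G Z M A (x x' : F Z M) (y : G M A) :
  tens (x + x') y = tens x y + tens x' y.
Proof. by have := tens_linear_l 1 x x' y; rewrite !scale1r. Qed.

Lemma push_tens F G Z M A A' (a : hom A A') (x : F Z M) (y : G M A) :
  push a (tens x y : tens_bimodule F G Z A) = tens x (push a y).
Proof. exact: tens_pushE. Qed.

Lemma pull_tens F G Z Z' M A (c : hom Z' Z) (x : F Z M) (y : G M A) :
  pull c (tens x y : tens_bimodule F G Z A) = tens (pull c x) y.
Proof. exact: tens_pullE. Qed.

(** A sum of pure tensors over [M] and [N] is one pure tensor over [M (+) N], so
    that arguments on the tensor product may be made on single symbols. *)
Lemma tens_pure F G Z A (u : tens_bimodule F G Z A) :
  exists M (x : F Z M) (y : G M A), u = tens x y.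
Proof.
elim/tens_ind: u => [|_ _ [M [x [y ->]]] [N [x' [y' ->]]]|k _ [M [x [y ->]]]|].
- by exists (zero_ob C), 0, 0; rewrite tens0l.
- pose b := sum_obP M N; exists (sum_ob M N).
  exists (push (bin1 b) x + push (bin2 b) x').
  exists (pull (bpr1 b) y + pull (bpr2 b) y').
  rewrite tensDl !tens_balanced !pullD -!pull_comp bpr1_in1 bpr2_in1 bpr1_in2.
  by rewrite bpr2_in2 !pull_id !pull_hom0 addr0 add0r.
- exists M, (k *: x), y.
  by rewrite -[k *: x]addr0 tens_linear_l tens0l addr0.
- by move=> M x y; exists M, x, y.
Qed.

End PureTensors.

Section HalfExactness.
Context (R : comPzRingType) (C : extriangulated_category R).
Implicit Types (F : bimodule C) (A B D M N Z : C).

(** If [x_* u = 0] then [x] extends along the inflation of a triangle realizing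
    [u]; the induced map of triangles (ET3) presents [u] as a pullback of
    [d]. *)
Lemma Ext_exact_left Z A B D (x : hom A B) (y : hom B D) (d : Ext D A)
    (u : Ext Z A) :
  realizes x y d -> push x u = 0 -> exists c : hom Z D, u = pull c d.
Proof.
move=> xyd xu0; have [N [i [p ipu]]] := real_ex u.
have [k xk] := triangle_push_lift ipu xu0.
have [|c [_ uc]] := et3 (a := idm A) (b := k) ipu xyd; first by rewrite compm1.
by exists c; rewrite -uc push_id.
Qed.

(** Only the covariant variable is concerned; the contravariant statements are
    obtained below by passing to the opposite category. *)
Definition half_exact F : Prop :=
  forall Z A B D (x : hom A B) (y : hom B D) (d : Ext D A) (u : F Z B),
  realizes x y d -> push y u = 0 -> exists v : F Z A, u = push x v.

(** Composing the inflation [x] with the one of a triangle realizing [u] (ET4)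
    gives a triangle that realizes [y_* u = 0], hence splits; a section of it
    pulls the composite extension back to a preimage of [u]. *)
Lemma Ext_half_exact : half_exact (@Ext R C).
Proof.
move=> Z A B D x y d u xyd yu0; have [N [i [p ipu]]] := real_ex u.
have [H [_ [p' [q [e [_ _ qr _ eu]]]]]] := et4 xyd ipu.
have [|s qs] := triangle_pull_lift (h := idm Z) qr; first by rewrite pull_id.
by exists (pull s e); rewrite push_pull eu -pull_comp -qs pull_id.
Qed.

(** ** When is a pure tensor zero?

    Write [A -i-> B -p-> N] for a triangle realizing [y] in [Ext N A]. If [v]
    comes from [F Z B] then [v (x) y = 0]. For half exact [F] the converse
    holds: [F (x) Ext] is the colimit, over the pairs [(N, y)], of the
    cokernels of [F Z B -> F Z N], and the transition map along a split
    inclusion is injective. Instead of building that colimit, formal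
    expressions are given a value, well defined up to [lifts], at each stage
    [(N, y)] that is large enough for them; congruent expressions then have the
    same value. *)
Section ZeroTensor.
Context (F : bimodule C) (F_exact : half_exact F) (Z A : C).

Definition lifts N (y : Ext N A) (v : F Z N) : Prop :=
  forall B (i : hom A B) (p : hom B N), realizes i p y ->
  exists w : F Z B, v = push p w.

Lemma lifts0 N (y : Ext N A) : lifts y 0.
Proof. by move=> B i p _; exists 0; rewrite push0. Qed.

Lemma liftsD N (y : Ext N A) v w : lifts y v -> lifts y w -> lifts y (v + w).
Proof.
move=> yv yw B i p ipy; have [v' ->] := yv B i p ipy.
by have [w' ->] := yw B i p ipy; exists (v' + w'); rewrite pushD.
Qed.

Lemma liftsZ N (y : Ext N A) k v : lifts y v -> lifts y (k *: v).
Proof.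
by move=> yv B i p /yv[v' ->]; exists (k *: v'); rewrite pushZ.
Qed.

Lemma lifts_subD N (y : Ext N A) v v' w w' :
  lifts y (v - v') -> lifts y (w - w') -> lifts y (v + w - (v' + w')).
Proof. by rewrite opprD addrACA; apply: liftsD. Qed.

Lemma lifts_subZ N (y : Ext N A) k v v' :
  lifts y (v - v') -> lifts y (k *: v - k *: v').
Proof. by rewrite -scalerBr; apply: liftsZ. Qed.

Lemma lifts_push N M (y : Ext N A) (c : hom M N) (x : F Z M) :
  pull c y = 0 -> lifts y (push c x).
Proof.
move=> cy0 B i p ipy; have [k ->] := triangle_pull_lift ipy cy0.
by exists (push k x); rewrite push_comp.
Qed.

(** The transition map along a split inclusion is injective. ET4op cuts the
    triangle of [y (+) y'] along [N -> N (+) N' -> N'] into the triangle of [y]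
    and one ending in [N'], at which half exactness is applied. *)
Lemma lifts_bin1 N N' (y : Ext N A) (y' : Ext N' A) (v : F Z N) :
  let b := sum_obP N N' in
  lifts (pull (bpr1 b) y + pull (bpr2 b) y') (push (bin1 b) v) -> lifts y v.
Proof.
set b := sum_obP N N' => /= lb B i p ipy.
have [Q [j [q jq]]] := real_ex (pull (bpr1 b) y + pull (bpr2 b) y').
have [w bv] := lb Q j q jq.
have [H [h [j' [q' [e [he [_ hq] jq' _ _]]]]]] :=
  et4_op jq (real_split N N').
have [|w' ww'] := F_exact (u := w) he.
  by rewrite push_comp -bv -push_comp bpr2_in1 push_hom0.
have v_w' : v = push q' w'.
  rewrite -[v]push_id -(bpr1_in1 b) push_comp bv ww'.
  rewrite -(push_comp q) hq -push_comp.
  by rewrite compA bpr1_in1 comp1m.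
have jqy : realizes j' q' y.
  move: jq'; rewrite pullD -!pull_comp bpr1_in1 bpr2_in1 pull_id pull_hom0.
  by rewrite addr0.
have [g [_ _ pg]] := real_unique jqy ipy.
by exists (push g w'); rewrite -push_comp pg.
Qed.

(** A symbol [x (x) y'] can be evaluated at [(N, y)] along any morphism that
    pulls [y] back to [y']; this makes [value] a relation rather than a
    function. *)
Fixpoint value N (y : Ext N A) (s : tens_expr F (@Ext R C) Z A) (v : F Z N) :
    Prop :=
  match s with
  | TZero => v = 0
  | TAdd s t => exists v1 v2, [/\ value y s v1, value y t v2 & v = v1 + v2]
  | TScale k s => exists2 v1, value y s v1 & v = k *: v1
  | TPure M x y' => exists2 c : hom M N, pull c y = y' & v = push c x
  end.

Lemma value_push N N' (y : Ext N A) (y' : Ext N' A) (c : hom N N') s v :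
  pull c y' = y -> value y s v -> value y' s (push c v).
Proof.
move=> cy; elim: s v => [v ->|s IHs t IHt v||] /=.
- by rewrite push0.
- move=> [v1 [v2 [/IHs s1 /IHt t2 ->]]].
  by exists (push c v1), (push c v2); split; rewrite ?pushD.
- by move=> k s IHs v [v1 /IHs s1 ->]; exists (push c v1); rewrite ?pushZ.
- move=> M x _ v [c' <- ->]; exists (c \oc c'); last by rewrite push_comp.
  by rewrite pull_comp cy.
Qed.

(** The direct sum of the extensions occurring in an expression is a stage at
    which it has a value. *)
Lemma value_ex s : exists N (y : Ext N A) v, value y s v.
Proof.
elim: s => [|s [N [y [v sv]]] t [N' [y' [v' tv]]]|k s [N [y [v sv]]]|M x y] /=.
- by exists (zero_ob C), 0, 0.
- pose b := sum_obP N N'; exists (sum_ob N N').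
  exists (pull (bpr1 b) y + pull (bpr2 b) y').
  exists (push (bin1 b) v + push (bin2 b) v').
  exists (push (bin1 b) v), (push (bin2 b) v'); split=> //.
    apply: value_push sv; rewrite pullD -!pull_comp bpr1_in1 bpr2_in1.
    by rewrite pull_id pull_hom0 addr0.
  apply: value_push tv; rewrite pullD -!pull_comp bpr1_in2 bpr2_in2.
  by rewrite pull_id pull_hom0 add0r.
- by exists N, y, (k *: v), v.
- by exists M, y, x, (idm M); rewrite ?pull_id ?push_id.
Qed.

Lemma value_uniq N (y : Ext N A) s v w :
  value y s v -> value y s w -> lifts y (v - w).
Proof.
elim: s v w => [v w -> ->|s IHs t IHt v w|k s IHs v w|M x y' v w] /=.
- by rewrite subrr; apply: lifts0.
- move=> [v1 [v2 [s1 t2 ->]]] [w1 [w2 [s1' t2' ->]]].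
  by apply: lifts_subD; [apply: IHs | apply: IHt].
- by move=> [v1 s1 ->] [w1 s1' ->]; apply/lifts_subZ/IHs.
- move=> [c cy ->] [c' cy' ->]; rewrite -push_homB.
  by apply: lifts_push; rewrite pull_homB cy cy' subrr.
Qed.

(** Each generating relation holds at every stage, because two morphisms that
    pull [y] back to the same extension differ by one that factors through [B].
    Transitivity needs [lifts_bin1]: the middle expression may only have a
    value at a larger stage. *)
Lemma value_eq s t : tens_eq s t -> forall N (y : Ext N A) v w,
  value y s v -> value y t w -> lifts y (v - w).
Proof.
elim=> {s t}.
- by move=> s N y v w; apply: value_uniq.
- move=> s t _ IH N y v w sv tw; rewrite -opprB -scaleN1r.
  exact/liftsZ/IH.
- move=> s t u _ IHst _ IHtu N y v w sv uw.
  (* compare at the stage that adds the extensions used by [t] *)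
  have [N' [y' [v' tv']]] := value_ex t; pose b := sum_obP N N'.
  pose y2 := pull (bpr1 b) y + pull (bpr2 b) y'.
  have b1 : pull (bin1 b) y2 = y.
    by rewrite pullD -!pull_comp bpr1_in1 bpr2_in1 pull_id pull_hom0 addr0.
  have b2 : pull (bin2 b) y2 = y'.
    by rewrite pullD -!pull_comp bpr1_in2 bpr2_in2 pull_id pull_hom0 add0r.
  apply: (@lifts_bin1 N N' y y'); rewrite -/b -/y2.
  have pushB : push (bin1 b) (v - w) = push (bin1 b) v - push (bin1 b) w.
    by rewrite pushD -scaleN1r pushZ scaleN1r.
  rewrite pushB -(subrKA (push (bin2 b) v')); apply: liftsD.
    by apply: IHst; [apply: value_push sv | apply: value_push tv'].
  by apply: IHtu; [apply: value_push tv' | apply: value_push uw].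
- move=> s s' t t' _ IHs _ IHt N y v w /=.
  move=> [v1 [v2 [s1 t2 ->]]] [w1 [w2 [s1' t2' ->]]].
  by apply: lifts_subD; [apply: IHs | apply: IHt].
- move=> k s s' _ IHs N y v w /= [v1 s1 ->] [w1 s1' ->].
  exact/lifts_subZ/IHs.
- move=> s t u N y v w /= [v1 [_ [s1 [v2 [v3 [t2 u3 ->]]] ->]]].
  move=> [_ [w3 [[w1 [w2 [s1' t2' ->]]] u3' ->]]]; rewrite addrA.
  apply: lifts_subD; last exact: (value_uniq u3 u3').
  apply: lifts_subD; first exact: (value_uniq s1 s1').
  exact: (value_uniq t2 t2').
- move=> s t N y v w /= [v1 [v2 [s1 t2 ->]]] [w1 [w2 [t1 s2 ->]]].
  rewrite [v1 + _]addrC.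
  by apply: lifts_subD; [apply: (value_uniq t2 t1) | apply: (value_uniq s1 s2)].
- move=> s N y v w /= [_ [v2 [-> s2 ->]]] s1; rewrite add0r.
  exact: value_uniq s2 s1.
- move=> k l s N y v w /= [_ [v1 s1 ->] ->] [w1 s1' ->].
  by rewrite scalerA; apply/lifts_subZ/(value_uniq s1 s1').
- by move=> s N y v w /= [v1 s1 ->] ->; rewrite scale0r subrr; apply: lifts0.
- move=> s N y v w /= [v1 s1 ->] s1'; rewrite scale1r.
  exact: value_uniq s1 s1'.
- move=> k s t N y v w /= [_ [v1 [v2 [s1 t2 ->]]] ->].
  move=> [_ [_ [[w1 s1' ->] [w2 t2' ->] ->]]]; rewrite scalerDr.
  apply: lifts_subD; apply: lifts_subZ; first exact: value_uniq s1 s1'.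
  exact: value_uniq t2 t2'.
- move=> k l s N y v w /= [v1 s1 ->] [_ [_ [[w1 s1' ->] [w2 s2' ->] ->]]].
  rewrite scalerDl; apply: lifts_subD; apply: lifts_subZ.
    exact: value_uniq s1 s1'.
  exact: value_uniq s1 s2'.
- move=> M k x x' y0 N y v w /= [c cy ->].
  move=> [_ [_ [[_ [c1 c1y ->] ->] [c2 c2y ->] ->]]]; rewrite push_linear.
  apply: lifts_subD; first apply: lifts_subZ.
    by rewrite -push_homB; apply: lifts_push; rewrite pull_homB cy c1y subrr.
  by rewrite -push_homB; apply: lifts_push; rewrite pull_homB cy c2y subrr.
- move=> M k x y1 y2 N y v w /= [c cy ->].
  move=> [_ [_ [[_ [c1 c1y ->] ->] [c2 c2y ->] ->]]].
  rewrite -push_linear_hom -push_homB; apply: lifts_push.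
  by rewrite pull_homB pull_linear_hom cy c1y c2y subrr.
- move=> M M' m x y0 N y v w /= [c cy ->] [c' c'y ->].
  rewrite -push_comp -push_homB; apply: lifts_push.
  by rewrite pull_homB pull_comp cy c'y subrr.
Qed.

Lemma tens_eq0_lifts M (x : F Z M) (y : Ext M A) : tens x y = 0 -> lifts y x.
Proof.
move/smpiP=> xy0; rewrite -[x]subr0.
by apply: (value_eq xy0) => //; exists (idm M); rewrite ?pull_id ?push_id.
Qed.

End ZeroTensor.

Section LongExactSequence.
Context (F : bimodule C) (F_exact : half_exact F) (A B D : C)
  (a : hom A B) (b : hom B D) (d : Ext D A) (abd : realizes a b d).

Lemma tens_exact_left Z (v : F Z D) :
  tens v d = 0 -> exists w : F Z B, v = push b w.
Proof. by move/(tens_eq0_lifts F_exact)/(_ _ _ _ abd). Qed.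

(** If [a_* (x (x) y) = x (x) a_* y] vanishes, then [x] comes from the middle
    term of the triangle of [a_* y]. There [y] pulls back into the kernel of
    [a_*], that is, to a pullback of [d]. *)
Lemma tens_exact_mid Z (u : tens_bimodule F (@Ext R C) Z A) :
  push a u = 0 -> exists v : F Z D, u = tens v d.
Proof.
have [M [x [y ->]]] := tens_pure u; rewrite push_tens => xy0.
have [N [i [p ipy]]] := real_ex (push a y).
have [w ->] := tens_eq0_lifts F_exact xy0 ipy.
have [|c py] := Ext_exact_left abd (u := pull p y).
  by rewrite push_pull (triangle_pull0 ipy).
by exists (push c w); rewrite !tens_balanced py.
Qed.

(** As for [tens_exact_mid], with half exactness of [Ext] in the last step. *)
Lemma tens_exact_right Z (u : tens_bimodule F (@Ext R C) Z B) :
  push b u = 0 -> exists v : tens_bimodule F (@Ext R C) Z A, u = push a v.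
Proof.
have [M [x [y ->]]] := tens_pure u; rewrite push_tens => xy0.
have [N [i [p ipy]]] := real_ex (push b y).
have [w ->] := tens_eq0_lifts F_exact xy0 ipy.
have [|y' py] := Ext_half_exact (u := pull p y) abd.
  by rewrite push_pull (triangle_pull0 ipy).
by exists (tens w y'); rewrite tens_balanced py push_tens.
Qed.
End LongExactSequence.

Lemma hExt_half_exact i : half_exact (@hExt R C i.+1).
Proof.
elim: i => [|i IH]; first exact: Ext_half_exact.
move=> Z A B D a b d u abd; exact: (tens_exact_right IH abd).
Qed.
End HalfExactness.

(** * Isomorphisms between tensor products of bimodules *)

Section BimoduleIso.
Context (R : comPzRingType) (C : additive_category R).
Implicit Types (F G H : bimodule C).

Record bimodule_map F G (phi : forall Z A : C, F Z A -> G Z A) : Prop := {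
  bmap_linear : forall Z A k (x y : F Z A),
    phi Z A (k *: x + y) = k *: phi Z A x + phi Z A y;
  bmap_push : forall Z A A' (a : hom A A') (x : F Z A),
    phi Z A' (push a x) = push a (phi Z A x);
  bmap_pull : forall Z Z' A (c : hom Z' Z) (x : F Z A),
    phi Z' A (pull c x) = pull c (phi Z A x) }.

Definition bimodule_iso F G : Prop :=
  exists (phi : forall Z A, F Z A -> G Z A) (psi : forall Z A, G Z A -> F Z A),
  [/\ bimodule_map phi, bimodule_map psi,
      forall Z A x, psi Z A (phi Z A x) = x
    & forall Z A x, phi Z A (psi Z A x) = x].

Lemma bimodule_iso_refl F : bimodule_iso F F.
Proof. by exists (fun _ _ x => x), (fun _ _ x => x). Qed.

Lemma bimodule_iso_sym F G : bimodule_iso F G -> bimodule_iso G F.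
Proof. by move=> [phi [psi []]]; exists psi, phi. Qed.

Lemma bimodule_map_comp F G H (phi : forall Z A, F Z A -> G Z A)
    (psi : forall Z A, G Z A -> H Z A) :
  bimodule_map phi -> bimodule_map psi ->
  bimodule_map (fun Z A x => psi Z A (phi Z A x)).
Proof.
move=> [l1 s1 p1] [l2 s2 p2]; split=> *.
- by rewrite l1 l2.
- by rewrite s1 s2.
- by rewrite p1 p2.
Qed.

Lemma bimodule_iso_trans F G H :
  bimodule_iso F G -> bimodule_iso G H -> bimodule_iso F H.
Proof.
move=> [f [f' [mf mf' ff' f'f]]] [g [g' [mg mg' gg' g'g]]].
exists (fun Z A x => g Z A (f Z A x)), (fun Z A x => f' Z A (g' Z A x)).
split; try exact: bimodule_map_comp.
- by move=> Z A x; rewrite gg' ff'.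
- by move=> Z A x; rewrite f'f g'g.
Qed.

Lemma bmap_zero F G phi Z A : @bimodule_map F G phi -> phi Z A 0 = 0.
Proof.
move=> m.
by rewrite -(push_hom0 A (0 : F Z A)) (bmap_push m) push_hom0.
Qed.

Lemma bimodule_iso_eq0 F G Z A :
  bimodule_iso F G -> (forall u : F Z A, u = 0) -> forall u : G Z A, u = 0.
Proof.
move=> [phi [psi [mphi _ _ psiK]]] F0 u.
by rewrite -(psiK _ _ u) (F0 (psi _ _ u)) (bmap_zero _ _ mphi).
Qed.

Record balanced F G H (phi : forall Z M A, F Z M -> G M A -> H Z A) : Prop := {
  bal_linear_l : forall Z M A k (x x' : F Z M) (y : G M A),
    phi Z M A (k *: x + x') y = k *: phi Z M A x y + phi Z M A x' y;
  bal_linear_r : forall Z M A k (x : F Z M) (y y' : G M A),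
    phi Z M A x (k *: y + y') = k *: phi Z M A x y + phi Z M A x y';
  bal_mid : forall Z M M' A (m : hom M M') (x : F Z M) (y : G M' A),
    phi Z M' A (push m x) y = phi Z M A x (pull m y);
  bal_push : forall Z M A A' (a : hom A A') (x : F Z M) (y : G M A),
    phi Z M A' x (push a y) = push a (phi Z M A x y);
  bal_pull : forall Z Z' M A (c : hom Z' Z) (x : F Z M) (y : G M A),
    phi Z' M A (pull c x) y = pull c (phi Z M A x y) }.

Lemma tens_map_ex F G H (phi : forall Z M A, F Z M -> G M A -> H Z A) :
  balanced phi ->
  exists2 f : forall Z A, tens_bimodule F G Z A -> H Z A,
    bimodule_map f & forall Z M A (x : F Z M) (y : G M A),
      f Z A (tens x y) = phi Z M A x y.
Proof.
move=> [linl linr bal psh pll].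
pose f Z A : tens_bimodule F G Z A -> H Z A := tens_lift (fun M => phi Z M A).
have fE Z M A (x : F Z M) (y : G M A) : f Z A (tens x y) = phi Z M A x y.
  by rewrite [LHS]tens_liftE.
have flin Z A k u v : f Z A (k *: u + v) = k *: f Z A u + f Z A v.
  by rewrite [LHS]tens_lift_linear.
exists f => //; split=> // [Z A A' a|Z Z' A c] u.
- by have [M [x [y ->]]] := tens_pure u; rewrite push_tens !fE.
- by have [M [x [y ->]]] := tens_pure u; rewrite pull_tens !fE.
Qed.

Lemma tens_map2_ex F F' G G' (f : forall Z A, F Z A -> F' Z A)
    (g : forall Z A, G Z A -> G' Z A) :
  bimodule_map f -> bimodule_map g ->
  exists2 h : forall Z A, tens_bimodule F G Z A -> tens_bimodule F' G' Z A,
    bimodule_map h & forall Z M A (x : F Z M) (y : G M A),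
      h Z A (tens x y) = tens (f _ _ x) (g _ _ y).
Proof.
move=> [fl fs fp] [gl gs gp].
apply: (@tens_map_ex F G (tens_bimodule F' G')
         (fun Z M A x y => tens (f _ _ x) (g _ _ y))).
split=> *.
- by rewrite fl tens_linear_l.
- by rewrite gl tens_linear_r.
- by rewrite fs gp tens_balanced.
- by rewrite gs push_tens.
- by rewrite fp pull_tens.
Qed.

Lemma tens_iso_congr F F' G G' :
  bimodule_iso F F' -> bimodule_iso G G' ->
  bimodule_iso (tens_bimodule F G) (tens_bimodule F' G').
Proof.
move=> [f [f' [mf mf' ff' f'f]]] [g [g' [mg mg' gg' g'g]]].
have [h mh hE] := tens_map2_ex mf mg.
have [h' mh' h'E] := tens_map2_ex mf' mg'.
exists h, h'; split=> // Z A u; have [M [x [y ->]]] := tens_pure u.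
- by rewrite hE h'E ff' gg'.
- by rewrite h'E hE f'f g'g.
Qed.

Lemma tens_iso_assoc F G H :
  bimodule_iso (tens_bimodule (tens_bimodule F G) H)
               (tens_bimodule F (tens_bimodule G H)).
Proof.
pose FG := tens_bimodule F G; pose GH := tens_bimodule G H.
have [f f_bal fE] : exists2 f : forall Z M A,
    FG Z M -> H M A -> tens_bimodule F GH Z A,
    balanced f & forall Z M A N (x : F Z N) (y : G N M) (z : H M A),
      f Z M A (tens x y) z = tens x (tens y z : GH N A).
  pose f Z M A (u : FG Z M) z := tens_lift (V := tens_bimodule F GH Z A)
    (fun N x y => tens x (tens y z : GH N A)) u.
  have fE Z M A N (x : F Z N) (y : G N M) (z : H M A) :
      f Z M A (tens x y) z = tens x (tens y z : GH N A).
    rewrite [LHS]tens_liftE // => *.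
    - by rewrite tens_linear_l.
    - by rewrite tens_linear_l -tens_linear_r.
    - by rewrite tens_balanced pull_tens.
  exists f => //; split.
  - move=> Z M A k u v z; rewrite [LHS]tens_lift_linear // => *.
    + by rewrite tens_linear_l.
    + by rewrite tens_linear_l -tens_linear_r.
    + by rewrite tens_balanced pull_tens.
  - move=> Z M A k u z z'; have [N [x [y ->]]] := tens_pure u.
    by rewrite !fE !tens_linear_r.
  - move=> Z M M' A m u z; have [N [x [y ->]]] := tens_pure u.
    by rewrite push_tens !fE tens_balanced.
  - move=> Z M A A' a u z; have [N [x [y ->]]] := tens_pure u.
    by rewrite !fE !push_tens.
  - move=> Z Z' M A c u z; have [N [x [y ->]]] := tens_pure u.
    by rewrite pull_tens !fE pull_tens.
have [g g_bal gE] : exists2 g : forall Z M A,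
    F Z M -> GH M A -> tens_bimodule FG H Z A,
    balanced g & forall Z M A N (x : F Z M) (y : G M N) (z : H N A),
      g Z M A x (tens y z) = tens (tens x y : FG Z N) z.
  pose g Z M A x (u : GH M A) := tens_lift (V := tens_bimodule FG H Z A)
    (fun N y z => tens (tens x y : FG Z N) z) u.
  have gE Z M A N (x : F Z M) (y : G M N) (z : H N A) :
      g Z M A x (tens y z) = tens (tens x y : FG Z N) z.
    rewrite [LHS]tens_liftE // => *.
    - by rewrite tens_linear_r -tens_linear_l.
    - by rewrite tens_linear_r.
    - by rewrite -tens_balanced push_tens.
  exists g => //; split.
  - move=> Z M A k x x' u; have [N [y [z ->]]] := tens_pure u.
    by rewrite !gE !tens_linear_l.
  - move=> Z M A k x u v; rewrite [LHS]tens_lift_linear // => *.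
    + by rewrite tens_linear_r -tens_linear_l.
    + by rewrite tens_linear_r.
    + by rewrite -tens_balanced push_tens.
  - move=> Z M M' A m x u; have [N [y [z ->]]] := tens_pure u.
    by rewrite pull_tens !gE tens_balanced.
  - move=> Z M A A' a x u; have [N [y [z ->]]] := tens_pure u.
    by rewrite push_tens !gE push_tens.
  - move=> Z Z' M A c x u; have [N [y [z ->]]] := tens_pure u.
    by rewrite !gE !pull_tens.
have [f' mf' f'E] := tens_map_ex f_bal; have [g' mg' g'E] := tens_map_ex g_bal.
exists f', g'; split=> // Z A u.
  have [M [v [z ->]]] := tens_pure u; have [N [x [y ->]]] := tens_pure v.
  by rewrite f'E fE g'E gE.
have [M [x [v ->]]] := tens_pure u; have [N [y [z ->]]] := tens_pure v.
by rewrite g'E gE f'E fE.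
Qed.

(** The last factor of a power moves past the others by induction, with a
    reassociation at each step. *)
Lemma tens_power_comm F i :
  bimodule_iso (tens_bimodule (tens_power F i.+1) F)
               (tens_bimodule F (tens_power F i.+1)).
Proof.
elim: i => [|i IH]; first exact: bimodule_iso_refl.
apply: (bimodule_iso_trans (tens_iso_congr IH (bimodule_iso_refl F))).
exact: tens_iso_assoc.
Qed.
End BimoduleIso.

(** * The opposite extriangulated category *)

Section Opposite.
Context (R : comPzRingType).

Program Definition op_linear (C : linear_category R) : linear_category R :=
  @LinearCategory R C (fun A B => hom B A) (fun A => idm A)
    (fun A B D g f => f \oc g) _ _ _ _ _.
Next Obligation. by move=> * /=; rewrite compA. Qed.
Next Obligation. by move=> * /=; rewrite compm1. Qed.
Next Obligation. by move=> * /=; rewrite comp1m. Qed.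
Next Obligation. by move=> * /=; rewrite comp_linear_r. Qed.
Next Obligation. by move=> * /=; rewrite comp_linear_l. Qed.

Definition op_biproduct (C : linear_category R) (A B P : C)
    (b : biproduct A B P) : @biproduct R (op_linear C) B A P :=
  @Biproduct R (op_linear C) B A P (bpr2 b) (bpr1 b) (bin2 b) (bin1 b)
    (bpr2_in2 b) (bpr1_in1 b) (bpr1_in2 b) (bpr2_in1 b)
    (etrans (addrC _ _) (bin_pr b)).

(** Direct sums are taken in the opposite order, so that the split triangles of
    the opposite category are literally those of [C]. *)
Definition op_additive (C : additive_category R) : additive_category R :=
  @AdditiveCategory R (op_linear C) (zero_ob C) (zero_obP C)
    (fun A B => sum_ob B A) (fun A B => op_biproduct (sum_obP B A)).

Program Definition op_bimodule (C : linear_category R) (F : bimodule C) :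
    bimodule (op_linear C) :=
  @Bimodule R (op_linear C) (fun Z A => F A Z)
    (fun Z A A' a x => @pull R C F A A' Z a x)
    (fun Z Z' A c x => @push R C F A Z Z' c x) _ _ _ _ _ _ _ _ _.
Next Obligation. by move=> * /=; rewrite pull_linear. Qed.
Next Obligation. by move=> * /=; rewrite pull_linear_hom. Qed.
Next Obligation. by move=> * /=; rewrite pull_id. Qed.
Next Obligation. by move=> * /=; rewrite pull_comp. Qed.
Next Obligation. by move=> * /=; rewrite push_linear. Qed.
Next Obligation. by move=> * /=; rewrite push_linear_hom. Qed.
Next Obligation. by move=> * /=; rewrite push_id. Qed.
Next Obligation. by move=> * /=; rewrite push_comp. Qed.
Next Obligation. by move=> * /=; rewrite push_pull. Qed.

Lemma seq_equiv_op (C : linear_category R) (A B B' D : C) (x : hom A B)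
    (y : hom B D) (x' : hom A B') (y' : hom B' D) :
  @seq_equiv R (op_linear C) D B B' A y x y' x' -> seq_equiv x y x' y'.
Proof.
move=> [b [[b' [bb' b'b]] yb xb]]; exists b'; split.
- by exists b.
- by rewrite -xb compA [X in X \oc _]b'b comp1m.
- by rewrite -yb -compA [X in _ \oc X]bb' compm1.
Qed.

Lemma op_seq_equiv (C : linear_category R) (A B B' D : C) (x : hom A B)
    (y : hom B D) (x' : hom A B') (y' : hom B' D) :
  seq_equiv x y x' y' -> @seq_equiv R (op_linear C) D B B' A y x y' x'.
Proof.
move=> [b [[b' [b'b bb']] bx yb]]; exists b'; split.
- by exists b.
- by rewrite /= -yb -compA bb' compm1.
- by rewrite /= -bx compA b'b comp1m.
Qed.

Program Definition op_extriangulated (C : extriangulated_category R) :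
    extriangulated_category R :=
  @ExtriangulatedCategory R (op_additive C) (op_bimodule (@Ext R C))
    (fun A B D x y d => @realizes R C D B A y x d) _ _ _ _ _ _ _ _ _ _.
Next Obligation.
move=> C A D d; have [B [x [y xyd]]] := real_ex (d : @Ext R C A D).
by exists B, y, x.
Qed.
Next Obligation.
move=> C A B B' D d x y x' y' r r'.
by have := real_unique r r'; apply: op_seq_equiv.
Qed.
Next Obligation.
move=> C A B B' D d x y x' y' r e; apply: (real_equiv r).
exact: seq_equiv_op e.
Qed.
Next Obligation.
move=> C A B D A' B' D' x y d x' y' d' a c r r' e.
by have [b [b1 b2]] := real_mor r' r (esym e); exists b.
Qed.
Next Obligation.
move=> C A D; exact: (real_split D A).
Qed.
Next Obligation.
move=> C A B D A' B' D' x y d x' y' d' r r'.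
have := real_sum r' r; rewrite /sum_mor /sum_ext /= !compA -!push_pull.
rewrite [X in realizes X _ _]addrC [X in realizes _ X _]addrC.
by rewrite [X in realizes _ _ X]addrC.
Qed.
Next Obligation.
move=> C A B D A' B' D' x y d x' y' d' a b r r' e.
by have [c [c1 c2]] := et3_op r' r (esym e); exists c.
Qed.
Next Obligation.
move=> C A B D A' B' D' x y d x' y' d' b c r r' e.
by have [a [a1 a2]] := et3 r' r (esym e); exists a.
Qed.
Next Obligation.
move=> C A B D K F f f' d g g' d' r r'.
have [H [h [p [q [e [h1 [h2 h3] h4 h5 h6]]]]]] := et4_op r' r.
by exists H, h, q, p, e; split=> //=.
Qed.
Next Obligation.
move=> C D A B F K f' f d g' g d' r r'.
have [H [h [p [q [e [h1 [h2 h3] h4 h5 h6]]]]]] := et4 r' r.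
by exists H, h, q, p, e; split=> //=.
Qed.

Lemma op_tens_iso (C : additive_category R) (F G : bimodule C) :
  @bimodule_iso R (op_additive C) (op_bimodule (tens_bimodule F G))
    (tens_bimodule (op_bimodule G) (op_bimodule F)).
Proof.
pose Fo : bimodule (op_additive C) := op_bimodule F.
pose Go : bimodule (op_additive C) := op_bimodule G.
have [f mf fE] : exists2 f : forall Z A : op_additive C,
      tens_bimodule Go Fo Z A -> op_bimodule (tens_bimodule F G) Z A,
    @bimodule_map R (op_additive C) _ (op_bimodule (tens_bimodule F G)) f
  & forall Z M A (y : Go Z M) (x : Fo M A),
      f Z A (tens y x) = @tens R C F G A M Z x y.
  apply: (@tens_map_ex R (op_additive C) Go Fo (op_bimodule (tens_bimodule F G))
    (fun Z M A y x => @tens R C F G A M Z x y)); split=> *.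
  - by rewrite [LHS]tens_linear_r.
  - by rewrite [LHS]tens_linear_l.
  - by rewrite [RHS]tens_balanced.
  - by rewrite [RHS]pull_tens.
  - by rewrite [RHS]push_tens.
pose swap Z M A (x : F A M) (y : G M Z) : tens_bimodule Go Fo Z A :=
  @tens R (op_additive C) Go Fo Z M A y x.
have [g mg gE] : exists2 g : forall Z A : C,
      tens_bimodule F G A Z -> tens_bimodule Go Fo Z A,
    @bimodule_map R (op_additive C) (op_bimodule (tens_bimodule F G)) _ g
  & forall Z M A (x : F A M) (y : G M Z), g Z A (tens x y) = swap Z M A x y.
  pose g Z A := tens_lift (fun M => swap Z M A).
  have gE Z M A (x : F A M) (y : G M Z) : g Z A (tens x y) = swap Z M A x y.
    rewrite [LHS]tens_liftE // => *.
    - by rewrite [LHS]tens_linear_r.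
    - by rewrite [LHS]tens_linear_l.
    - by rewrite [RHS](@tens_balanced R (op_additive C) Go Fo).
  exists g => //; split=> [Z A k u v|Z A A' a u|Z Z' A c u].
  - rewrite [LHS]tens_lift_linear // => *.
    - by rewrite [LHS]tens_linear_r.
    - by rewrite [LHS]tens_linear_l.
    - by rewrite [RHS](@tens_balanced R (op_additive C) Go Fo).
  - have [N [x [y ->]]] := tens_pure (u : tens_bimodule F G A Z).
    by rewrite gE [RHS]push_tens -[RHS]gE; congr (g _ _ _); apply: pull_tens.
  - have [N [x [y ->]]] := tens_pure (u : tens_bimodule F G A Z).
    by rewrite gE [RHS]pull_tens -[RHS]gE; congr (g _ _ _); apply: push_tens.
exists g, f; split=> // Z A u.
  have [M [x [y ->]]] := tens_pure (u : tens_bimodule F G A Z).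
  by rewrite gE fE.
by have [M [y [x ->]]] := tens_pure u; rewrite fE gE.
Qed.

(** Swapping factors puts the new one on the left of the power, while powers
    grow on the right: [tens_power_comm] moves it across. *)
Lemma op_tens_power_iso (C : additive_category R) (F : bimodule C) i :
  @bimodule_iso R (op_additive C) (op_bimodule (tens_power F i.+1))
    (@tens_power R (op_additive C) (op_bimodule F) i.+1).
Proof.
elim: i => [|i IH]; first exact: bimodule_iso_refl.
apply: (bimodule_iso_trans (op_tens_iso _ _)).
apply: (bimodule_iso_trans (tens_iso_congr (bimodule_iso_refl _) IH)).
exact/bimodule_iso_sym/tens_power_comm.
Qed.

Section Transfer.
Context (C : extriangulated_category R).
Notation Cop := (op_extriangulated C).

Lemma op_hExt_eq0 i (A B : C) : (1 <= i)%N ->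
  (forall u : hExt C i A B, u = 0) <-> (forall u : @hExt R Cop i B A, u = 0).
Proof.
case: i => // i _; have iso := op_tens_power_iso (@Ext R C) i.
split; first exact: bimodule_iso_eq0 iso.
exact: bimodule_iso_eq0 (bimodule_iso_sym iso).
Qed.

Program Definition op_subcategory (X : add_subcategory C) :
    add_subcategory Cop :=
  @AddSubcategory R Cop X _ (sub_zero X) _ _.
Next Obligation.
move=> X A B f [g [gf fg]]; apply: (@sub_iso _ _ X A B g).
by exists f.
Qed.
Next Obligation.
move=> X A B P [i1 i2 p1 p2 e1 e2 e3 e4 e5]; apply: (@sub_sum _ _ X A B).
exact: (@Biproduct R C A B P p1 p2 i1 i2).
Qed.
Next Obligation.
move=> X A B P [i1 i2 p1 p2 e1 e2 e3 e4 e5]; apply: (@sub_summand _ _ X A B).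
exact: (@Biproduct R C A B P p1 p2 i1 i2).
Qed.
End Transfer.
End Opposite.

(** * Approximation triangles and orthogonality *)

Section ApproximationTriangles.
Context (R : comPzRingType) (C : extriangulated_category R).
Context (X : add_subcategory C).
Implicit Types (A B D : C).

Definition right_perp_upto k A : Prop :=
  forall i, (1 <= i <= k)%N -> right_perp i X A.

Lemma split_triangle_mem A B D (x : hom A B) (y : hom B D) :
  realizes x y 0 -> X B -> X A.
Proof.
move=> xy0 XB.
have [b [[b' [b'b bb']] _ _]] := real_unique (real_split A D) xy0.
apply: (sub_summand (sum_obP A D)); apply: (sub_iso (f := b')) XB.
by exists b.
Qed.

(** Idempotents of [C] need not split, so a retract of an object of [X] is not
    at once a summand. But a section into an object of [X] factors through the
    left approximation of [A], which is then itself a section, and its triangle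
    splits. *)
Lemma idm_factors_mem A (T : left_app_triangle X A) :
  factors_through X (idm A) -> X A.
Proof.
case: T => M P x y d xyd [XM ext] [N [u [v [XN vu]]]].
have [w uwx] := ext N u XN.
apply: (split_triangle_mem (D := P) (x := x) (y := y)) XM.
suff <- : d = 0 by [].
by rewrite -[d]push_id vu uwx compA push_comp (triangle_push0 xyd) push0.
Qed.

Lemma mem_idm_factors A : X A -> factors_through X (idm A).
Proof. by move=> XA; exists A, (idm A), (idm A); rewrite comp1m. Qed.

(** The objects of [X] are exactly the zero objects of the ideal quotient, and
    naturality of a transformation between zero objects is automatic. *)
Lemma nat_isomorphic_zeroP (F : functor (ideal_quotient X) (ideal_quotient X)) :
    (forall A, left_app_triangle X A) ->
  nat_isomorphic F (zero_functor (ideal_quotient X) (ideal_quotient X)) <->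
  forall A : C, X (F A).
Proof.
move=> L; have factorsP (A : C) :
    @idm R (ideal_quotient X) A = 0 <-> factors_through X (idm A).
  by rewrite -[X in factors_through _ X]subr0; exact: quot_morP.
have zeroP (A : C) (u v : @hom R (ideal_quotient X) A (zero_ob C)) : u = v.
  by rewrite -[u]comp1m -[v]comp1m (zero_obP (ideal_quotient X)) !comp0m.
split=> [[eta [_ iso]] A|XF].
  have [g [ge _]] := iso A.
  apply: (idm_factors_mem (L _)); apply/factorsP.
  by rewrite -ge (zeroP _ (eta A) 0) compm0.
exists (fun=> 0); split=> [A B f|A]; first exact: zeroP.
exists 0; split; last exact: zeroP.
by rewrite compm0; apply/esym/factorsP/mem_idm_factors.
Qed.

(** Extensions of degree 1 by [A^-] vanish because morphisms to [A] lift to the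
    approximation; those of degree [i.+2] come from degree [i.+1] at [A]. *)
Lemma right_perp_upto_loop n k A (T : right_app_triangle X A) :
    rigid n X -> (k < n)%N -> right_perp_upto k A ->
  right_perp_upto k.+1 (ra_minus T).
Proof.
case: T => P M x y d xyd [XM app] /= Xn kn kA [//|[|i]] ik B XB e.
  have [|c ->] := Ext_exact_left xyd (u := e).
    by apply: (Xn 1%N) => //; apply: leq_ltn_trans kn.
  have [c' ->] := app B c XB.
  by rewrite pull_comp (triangle_pull0 xyd) pull0.
have [|v ->] := tens_exact_mid (@hExt_half_exact R C i) xyd (u := e).
  by apply: (Xn i.+2) => //; apply: leq_trans kn.
by rewrite (kA i.+1 ik B XB v) tens0l.
Qed.

(** The connecting map embeds degree [i] at [A^+] into degree [i.+1] at [A], as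
    the middle term is in [X]. *)
Lemma right_perp_upto_susp n k A (T : left_app_triangle X A) :
    rigid n X -> (k <= n)%N -> right_perp_upto k.+1 A ->
  right_perp_upto k (la_plus T).
Proof.
case: T => M P x y d xyd [XM app] /= Xn kn kA [//|i] ik B XB e.
have [|w ->] := tens_exact_left (@hExt_half_exact R C i) xyd (v := e).
  exact: (kA i.+2 ik B XB).
by rewrite (Xn i.+1 (leq_trans ik kn) B M XB XM w) push0.
Qed.

(** The extension class of the approximation triangle lies in [Ext A^+ A], so it
    is zero and [A] is a summand of its approximation. *)
Lemma right_perp_mem A (T : left_app_triangle X A) :
  right_perp 1 X A -> X (la_plus T) -> X A.
Proof.
case: T => M P x y d xyd [XM _] /= A1 XP.
by apply: (split_triangle_mem (x := x) (y := y)) XM; rewrite -(A1 P XP d).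
Qed.

Section Iterates.
Context (L : forall A, left_app_triangle X A).
Context (Q : forall A, right_app_triangle X A).

Definition susp_ob k A : C := iter k (fun A => la_plus (L A)) A.
Definition loop_ob k A : C := iter k (fun A => ra_minus (Q A)) A.

Lemma loop_ob_mem n : rigid n X ->
  (forall A, right_perp_upto n A -> X A) -> forall A, X (loop_ob n A).
Proof.
move=> Xn nX A; apply: nX; have: (n <= n)%N by [].
elim: {-2}n => [|k IH] kn; first by case.
exact: (right_perp_upto_loop (T := Q (loop_ob k A)) Xn kn (IH (ltnW kn))).
Qed.

(** Going up along the suspensions loses one degree of orthogonality at each
    step until [X] is reached; [right_perp_mem] then brings membership in [X]
    back down to [A]. *)
Lemma susp_ob_mem_perp n : rigid n X ->
  (forall A, X (susp_ob n A)) -> forall A, right_perp_upto n A -> X A.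
Proof.
move=> Xn XS A; have {XS} := XS A; have: (n <= n)%N by [].
elim: {-2}n A => [//|k IH] A kn; rewrite /susp_ob iterSr => XS kA.
apply: (@right_perp_mem _ (L A)); first exact: kA.
exact: (IH _ (ltnW kn) XS (right_perp_upto_susp Xn (ltnW kn) kA)).
Qed.

(** The part of the adjunction between suspension and loop that is needed: [f]
    is completed to a morphism of triangles with third component [h]. If [h]
    factors through [X], it lifts to the right approximation of [B], so the
    connecting class kills it, and [f] extends to the left approximation of
    [A]. *)
Lemma adjoint_factors A B :
  (forall h : hom (la_plus (L A)) B, factors_through X h) ->
  forall f : hom A (ra_minus (Q B)), factors_through X f.
Proof.
case: (L A) (Q B) => M P x y d xyd [XM ext].
move=> [P' M' x' y' d' xyd'] [XM' app] /= hX f.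
have [g gx] := ext M' (x' \oc f) XM'.
have [h [hy fd]] := et3 xyd xyd' (esym gx).
have [N [u [v [XN huv]]]] := hX h; have [t vt] := app N v XN.
have [|k ->] := triangle_push_lift (h := f) xyd.
  by rewrite fd huv vt !pull_comp (triangle_pull0 xyd') !pull0.
by exists M, x, k.
Qed.

Lemma adjoint_iter_factors k A B :
  (forall h : hom (susp_ob k A) B, factors_through X h) ->
  forall f : hom A (loop_ob k B), factors_through X f.
Proof.
elim: k A => [//|k IH] A; rewrite /susp_ob iterSr => hX.
exact/adjoint_factors/IH.
Qed.

Lemma susp_loop_mem n :
  (forall A, X (susp_ob n A)) -> forall A, X (loop_ob n A).
Proof.
move=> XS A; apply: (idm_factors_mem (L _)); apply: adjoint_iter_factors => h.
by rewrite -[h]compm1; apply/factors_compl/mem_idm_factors.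
Qed.

End Iterates.
End ApproximationTriangles.

(** * Duality and the equivalence *)

Section Duality.
Context (R : comPzRingType) (C : extriangulated_category R).
Context (X : add_subcategory C).
Notation Cop := (op_extriangulated C).
Notation Xop := (op_subcategory X).

Definition op_right_app_triangle (A : C) (T : right_app_triangle X A) :
    @left_app_triangle R Cop Xop A :=
  let: RightAppTriangle P M x y d xyd app := T in
  @LeftAppTriangle R Cop Xop A M P y x d xyd app.

Definition op_left_app_triangle (A : C) (T : left_app_triangle X A) :
    @right_app_triangle R Cop Xop A :=
  let: LeftAppTriangle M P x y d xyd app := T in
  @RightAppTriangle R Cop Xop A P M y x d xyd app.

Lemma op_rigid n : rigid n X -> rigid n Xop.
Proof.
move=> Xn i /andP[i1 i_n] A B XA XB; apply: (op_hExt_eq0 (C := C) B A i1).1.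
by apply: (Xn i) => //; rewrite i1.
Qed.

Lemma op_left_perp i A : (1 <= i)%N -> left_perp i X A <-> right_perp i Xop A.
Proof.
move=> i1; split=> pA B XB;
  last exact: (op_hExt_eq0 (C := C) A B i1).2 (pA B XB).
exact: (op_hExt_eq0 (C := C) A B i1).1 (pA B XB).
Qed.

Context (L : forall A, left_app_triangle X A).
Context (Q : forall A, right_app_triangle X A).

Lemma op_susp_ob k (A : C) :
  susp_ob (C := Cop) (fun A => op_right_app_triangle (Q A)) k A = loop_ob Q k A.
Proof. by elim: k => //= k ->; case: (Q _). Qed.

Lemma op_loop_ob k (A : C) :
  loop_ob (C := Cop) (fun A => op_left_app_triangle (L A)) k A = susp_ob L k A.
Proof. by elim: k => //= k ->; case: (L _). Qed.
End Duality.

Theorem theorem1p2 (R : comPzRingType) (n : nat) (n_ge1 : (1 <= n)%N)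
    (C : extriangulated_category R) (X : add_subcategory C)
    (X_sff : strongly_functorially_finite X) (X_rigid : rigid n X)
    (left_tri : forall A : C, left_app_triangle X A)
    (right_tri : forall A : C, right_app_triangle X A) :
  (((forall A : C, X A <-> forall i, (1 <= i <= n)%N -> left_perp i X A) /\
    (forall A : C, X A <-> forall i, (1 <= i <= n)%N -> right_perp i X A)) <->
   nat_isomorphic (iter_functor n (suspension left_tri))
                  (zero_functor (ideal_quotient X) (ideal_quotient X))) /\
  (nat_isomorphic (iter_functor n (suspension left_tri))
                  (zero_functor (ideal_quotient X) (ideal_quotient X)) <->
   nat_isomorphic (iter_functor n (loop right_tri))
                  (zero_functor (ideal_quotient X) (ideal_quotient X))).
Proof.
have suspP : nat_isomorphic (iter_functor n (suspension left_tri))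
    (zero_functor (ideal_quotient X) (ideal_quotient X)) <->
    forall A : C, X (susp_ob left_tri n A).
  rewrite nat_isomorphic_zeroP //.
  have e A : iter_functor n (suspension left_tri) A = susp_ob left_tri n A.
    by elim: (n) => //= k ->.
  by split=> XS A; have := XS A; rewrite e.
have loopP : nat_isomorphic (iter_functor n (loop right_tri))
    (zero_functor (ideal_quotient X) (ideal_quotient X)) <->
    forall A : C, X (loop_ob right_tri n A).
  rewrite nat_isomorphic_zeroP //.
  have e A : iter_functor n (loop right_tri) A = loop_ob right_tri n A.
    by elim: (n) => //= k ->.
  by split=> XS A; have := XS A; rewrite e.
rewrite suspP loopP.
pose oL (A : op_extriangulated C) := op_right_app_triangle (right_tri A).
pose oQ (A : op_extriangulated C) := op_left_app_triangle (left_tri A).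
have oS A : susp_ob oL n A = loop_ob right_tri n A := op_susp_ob right_tri n A.
have oO A : loop_ob oQ n A = susp_ob left_tri n A := op_loop_ob left_tri n A.
have S_O : (forall A, X (susp_ob left_tri n A)) ->
    forall A, X (loop_ob right_tri n A) by exact: susp_loop_mem.
have O_S : (forall A, X (loop_ob right_tri n A)) ->
    forall A, X (susp_ob left_tri n A).
  move=> XO A; rewrite -oO.
  apply: (susp_loop_mem (X := op_subcategory X) (L := oL)) => B.
  by rewrite oS; apply: XO.
have perpE A : (forall i, (1 <= i <= n)%N -> left_perp i X A) <->
    right_perp_upto (op_subcategory X) n A.
  by split=> pA i ik; apply/(op_left_perp X A (proj1 (andP ik)))/pA.
split; split=> // [[lX _]|XS].
  move=> A; rewrite -oO; apply: loop_ob_mem; first exact: op_rigid.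
  by move=> B /perpE/lX.
split=> A; split.
- by move=> XA i ik B XB; apply: (X_rigid i).
- move/perpE; apply: (susp_ob_mem_perp (L := oL)); first exact: op_rigid.
  by move=> B; rewrite oS; apply: S_O.
- by move=> XA i ik B XB; apply: (X_rigid i).
- exact: susp_ob_mem_perp.
Qed.
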